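(* Let $k\in\mathbb{N}$, $\rho>0$, and let $\mathcal{K}\subset\mathcal{D}_\rho(0)$ be a compact set such that $0\in\mathcal{K}$ and $\mathrm{card}(\mathcal{K})>k$. Let $\Omega$ be any open set such that $\mathcal{K}\subset\Omega$ and $\overline{\Omega}\subset\mathcal{D}_\rho(0)$. Then the functions of the family $\mathcal{V}(k,\rho)$ satisfy a uniform Bernstein-Remez inequality with respect to $\mathcal{K}$ and $\Omega$: there exists a number $\mathtt{C}=\mathtt{C}(k,\rho,\mathcal{K},\Omega)>0$ such that, for any $f\in\mathcal{V}(k,\rho)$, $$\max_{z\in\overline{\Omega}}|f(z)|\le \mathtt{C}\,\max_{z\in\mathcal{K}}|f(z)|.$$
   Context: $\mathcal{D}_\rho(0)\subset\mathbb{C}$ denotes the open complex disk of radius $\rho$ centered at the origin. For $k\in\mathbb{N}$ and $\rho>0$, $\mathcal{V}(k,\rho)$ is the set of functions $f$ such that: (1) $f$ is holomorphic over $\mathcal{D}_\rho(0)$; (2) there is a non-zero polynomial $S\in\mathbb{C}[z,w]$ of (total) degree at most $k$ such that the graph of $f$ is included in the algebraic curve $\mathtt{R}_S:=\{(z,w)\in\mathbb{C}^2: S(z,w)=0\}$, i.e. $S(z,f(z))=0$ for all $z\in\mathcal{D}_\rho(0)$; (3) for this $S$, the set $\mathtt{R}_S\cap(\mathcal{D}_\rho(0)\times\mathbb{C})$ is the union of at most $k$ elements, each of which is either a vertical line of the form $\{(z,w)\in\mathbb{C}^2: z=z_*\}$ or the graph of a holomorphic function over $\mathcal{D}_\rho(0)$,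 these graphs being pairwise disjoint. *)

(* Defs.v *)
(* The complex plane is [R[i]^o]: the field of complex numbers
   over [R : realType], with the topology of its modulus.  The modulus, and so
   the radii of balls, live in [R[i]] itself, whose order [x <= y] means that
   [y - x] is a nonnegative real. *)
From mathcomp Require Import all_boot all_order all_algebra.
From mathcomp Require Export complex.
(* The notations of mpoly clash with those of analysis. *)
From mathcomp Require Import -(notations) mpoly.
From mathcomp Require Import all_classical all_reals all_analysis.

Set Implicit Arguments.
Unset Strict Implicit.
Unset Printing Implicit Defensive.

Import Order.TTheory GRing.Theory Num.Theory.
Import numFieldNormedType.Exports.

Local Open Scope classical_set_scope.
Local Open Scope ring_scope.
Local Open Scope complex_scope.

Definition disk (R : realType) (rho : R) : set R[i]^o :=
  ball (0 : R[i]^o) rho%:C.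

(* The scalars of [R[i]^o] are complex, so [derivable f z 1] is the existence
   of the complex derivative of [f] at [z]. *)
Definition holomorphic_on (R : realType) (A : set R[i]^o)
    (f : R[i]^o -> R[i]^o) : Prop :=
  forall z, A z -> derivable f z 1.

Definition peval (R : realType) (S : mpoly 2 R[i]) (z w : R[i]) : R[i] :=
  meval (fun i : 'I_2 => if i == 0%N :> nat then z else w) S.

Definition curve (R : realType) (S : mpoly 2 R[i]) :
    set (R[i]^o * R[i]^o) :=
  [set p | peval S p.1 p.2 = 0].

Definition graph_on (R : realType) (A : set R[i]^o) (f : R[i]^o -> R[i]^o) :
    set (R[i]^o * R[i]^o) :=
  [set p | A p.1 /\ p.2 = f p.1].

Definition is_vertical_line (R : realType) (E : set (R[i]^o * R[i]^o)) : Prop :=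
  exists z0 : R[i]^o, E = [set p | p.1 = z0].

Definition is_holomorphic_graph (R : realType) (rho : R)
    (E : set (R[i]^o * R[i]^o)) : Prop :=
  exists g : R[i]^o -> R[i]^o,
    holomorphic_on (disk rho) g /\ E = graph_on (disk rho) g.

(* [msize S] is 1 + the total degree of [S], when [S] is nonzero.
   A function on the disk is represented by any of its extensions to the
   plane: no condition involves its values outside the disk. *)
Definition V (R : realType) (k : nat) (rho : R) : set (R[i]^o -> R[i]^o) :=
  [set f | holomorphic_on (disk rho) f /\
    exists S : mpoly 2 R[i],
      [/\ S <> 0,
          (msize S <= k.+1)%N,
          graph_on (disk rho) f `<=` curve S &
          exists F : set (set (R[i]^o * R[i]^o)),
            [/\ (F #<= `I_k)%card,
                forall E, F E -> is_vertical_line E \/ is_holomorphic_graph rho E,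
                trivIset (F `&` is_holomorphic_graph rho) id &
                curve S `&` (disk rho `*` setT) = \bigcup_(E in F) E]]].

Definition is_max_modulus (R : realType) (f : R[i]^o -> R[i]^o)
    (A : set R[i]^o) (M : R[i]) : Prop :=
  (exists2 z, A z & `|f z| = M) /\ (forall z, A z -> `|f z| <= M).

(* Main.v *)
Require Import Defs.
From mathcomp Require Import all_boot all_order all_algebra.
From mathcomp Require Import all_classical all_reals all_analysis.
From mathcomp Require Import separable ring lra.
From mathcomp Require Import -(notations) mpoly.

(** Write the equation of the curve as [S = \sum_j p_j(z) w^j], and let [P_j] be
    the sum of the moduli of the coefficients of [p_j].  All constants below
    depend on [k], [rho], [K] and [Omega] only.

    Between the disk of radius [r0] that contains [Omega] and the disk of radius
    [rho] there is, for each [S], a circle [|z| = r] that stays away from all the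
    zeros of all the [p_j]; on it [|p_j(z)|] is comparable with [P_j]
    ([exists_good_circle]).  Hence the Newton polygon of [S(z, .)] is, up to
    bounded factors, the same at all points of the circle, and the modulus of a
    root is confined to boundedly many windows that do not depend on the point.
    A continuous root has a connected range, so it cannot jump from one window to
    another: its modulus varies by at most a factor [B] along the circle
    ([circle_oscillation]).

    The maximum principle ([max_principle]) then bounds [|f|] on [Omega] by
    [B t], where [t = |f(r)|], and it remains to bound [t] by [m = max_K |f|].
    Suppose that [t] is much larger than [m].  On [K] the equation
    [S(z, f(z)) = 0] makes [p_0] small, and as [K] has more than [k] points,
    interpolation makes [P_0] small.  So [S(r, .)] has a root that is much smaller
    than [t] ([exists_small_root]).  This root lies on one of the holomorphic
    graphs of the third condition of the definition of [V], say of [h]; then [h]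
    is much smaller than [t] on the whole circle, hence inside it.  The graphs
    being disjoint, [f - h] vanishes nowhere ([graphs_agree]), and the maximum
    principle for [1 / (f - h)] makes [|f - h|], thus [|f|], at least a constant
    times [t] inside the circle, in particular on [K]: a contradiction
    ([uniform_bound_V]).

    The maximum principle is obtained without integration.  Let [T] be
    squarefree as a polynomial in [w] over the rational functions of [z], with a
    power of [T] that is a multiple of [S].  Off finitely many values of [z], the
    zeros of [S] are zeros of [T] and, by Bezout, [T] and its derivative in [w]
    have no common zero; there the equation [T(z, f(z)) = 0] can be solved to
    give [f] a Taylor expansion of order 2 ([algebraic_jet]).  Such an expansion
    forbids a local maximum of [|f|^2 + delta |z|^2], since the mean of this
    function over the vertices of a small square centred at [z] exceeds its value
    at [z] ([jet2_no_max]).  The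
    finitely many bad points are removed by multiplying a power [f^n] by a
    polynomial that vanishes there, and letting [n] tend to infinity. *)

Set Implicit Arguments.
Unset Strict Implicit.
Unset Printing Implicit Defensive.

Import Order.TTheory GRing.Theory Num.Theory.
Import numFieldNormedType.Exports.
Import Normc.

Local Open Scope classical_set_scope.
Local Open Scope ring_scope.
Local Open Scope complex_scope.

(** * The modulus of a complex number as a real number *)

Section ComplexModulus.
Variable R : realType.
Local Notation C := (R[i]^o).

Lemma normr_normc (z : R[i]) : `|z| = (normc z)%:C.
Proof. by case: z => a b; rewrite normc_def. Qed.

Lemma normc_ge0 (z : R[i]) : 0 <= normc z.
Proof. by case: z => a b; exact: sqrtr_ge0. Qed.

Lemma le_normcB (x y : R[i]) : normc (x - y) <= normc x + normc y.
Proof. by rewrite -(normcN y); apply: le_normcD. Qed.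

Lemma complex_gt0P (e : R[i]) : 0 < e -> exists2 d : R, 0 < d & e = d%:C.
Proof.
case: e => a b; rewrite ltcE /= => /andP[/eqP -> a0]; exists a => //.
Qed.

(** Neighbourhoods in [R[i]^o] are defined with radii in [R[i]]; this is the passage
    to real radii, on which all the estimates below are made. *)
Lemma near_normcP (z0 : C) (P : set C) :
  (\forall z \near z0, P z) <->
  (exists2 d : R, 0 < d & forall z : C, normc (z - z0) < d -> P z).
Proof.
split.
  move=> /nbhs_ballP[e /complex_gt0P[d d0 ->] H]; exists d => // z hz.
  apply: H; rewrite /ball /= distrC normr_normc ltcR //.
move=> [d d0 H]; apply/nbhs_ballP; exists d%:C; first by rewrite /= ltcR.
by move=> z; rewrite /ball /= distrC normr_normc ltcR => /H.
Qed.

Lemma continuous_normcP (z0 : C) (f : C -> C) :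
  {for z0, continuous f} <->
  (forall e : R, 0 < e -> \forall z \near z0, normc (f z - f z0) < e).
Proof.
split.
  move=> H e e0; apply: (H [set w : C | normc (w - f z0) < e]).
  by apply/near_normcP; exists e.
move=> H P /near_normcP[d d0 hd]; have /near_normcP[r r0 hr] := H d d0.
by apply/near_normcP; exists r => // z hz; apply: hd; apply: hr.
Qed.

Lemma diskP (rho : R) (z : C) : disk rho z <-> normc z < rho.
Proof. by rewrite /disk /ball /= sub0r normrN normr_normc ltcR. Qed.

Lemma holomorphic_continuous (A : set C) (f : C -> C) (z : C) :
  holomorphic_on A f -> A z -> {for z, continuous f}.
Proof.
move=> H /H df.
by apply: differentiable_continuous; apply/derivable1_diffP.
Qed.

End ComplexModulus.

(** * Weighted sums of the moduli of the coefficients *)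

Section CoefficientNorms.
Variable R : realType.
Local Notation C := R[i].
Implicit Types (p q : {poly C}) (t : R).

(** For [t = 1] this is the size of a polynomial used throughout; other weights
    measure polynomials at the scale [|z| = t]. *)
Definition wnorm t p : R := \sum_(i < size p) normc p`_i * t ^+ i.

Lemma wnormE t p n : (size p <= n)%N -> wnorm t p = \sum_(i < n) normc p`_i * t ^+ i.
Proof.
move=> h; rewrite /wnorm (big_ord_widen n (fun i => normc p`_i * t ^+ i) h).
rewrite big_mkcond; apply: eq_bigr => i _; case: ltnP => // hi.
by rewrite nth_default // normc0 mul0r.
Qed.

Lemma wnorm_ge0 t p : 0 <= t -> 0 <= wnorm t p.
Proof. by move=> t0; apply: sumr_ge0 => i _; rewrite mulr_ge0 ?normc_ge0 ?exprn_ge0. Qed.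

Lemma coef_le_wnorm t p i : 0 <= t -> normc p`_i * t ^+ i <= wnorm t p.
Proof.
move=> t0; have [hi|hi] := ltnP i (size p); last first.
  by rewrite nth_default // normc0 mul0r wnorm_ge0.
rewrite /wnorm (bigD1 (Ordinal hi)) //= lerDl sumr_ge0 // => j _.
by rewrite mulr_ge0 ?normc_ge0 ?exprn_ge0.
Qed.

Lemma wnormD t p q : 0 <= t -> wnorm t (p + q) <= wnorm t p + wnorm t q.
Proof.
move=> t0; set n := maxn (size p) (size q).
rewrite (@wnormE t (p + q) n) ?size_polyD // (@wnormE t p n) ?leq_maxl //.
rewrite (@wnormE t q n) ?leq_maxr // -big_split /=; apply: ler_sum => i _.
by rewrite -mulrDl ler_wpM2r ?exprn_ge0 // coefD le_normcD.
Qed.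

Lemma wnormZ t (c : C) p : wnorm t (c *: p) = normc c * wnorm t p.
Proof.
rewrite (@wnormE t (c *: p) (size p)) ?size_scale_leq // mulr_sumr.
by apply: eq_bigr => i _; rewrite coefZ normcM mulrA.
Qed.

Lemma wnormC t (c : C) : wnorm t c%:P = normc c.
Proof.
by rewrite (@wnormE t _ 1) ?size_polyC_leq1 // big_ord1 coefC eqxx expr0 mulr1.
Qed.

Lemma wnormMX t p : wnorm t (p * 'X) = t * wnorm t p.
Proof.
rewrite (@wnormE t (p * 'X) (size p).+1); last first.
  by apply: leq_trans (size_polyMleq _ _) _; rewrite size_polyX addn2.
rewrite big_ord_recl coefMX eqxx normc0 mul0r add0r mulr_sumr.
by apply: eq_bigr => i _; rewrite coefMX /= exprS mulrCA.
Qed.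

Lemma wnormM_XsubC t p b : 0 <= t ->
  wnorm t (p * ('X - b%:P)) <= (normc b + t) * wnorm t p.
Proof.
move=> t0; have -> : p * ('X - b%:P) = p * 'X + (- b) *: p.
  by rewrite mulrBr (mulrC p b%:P) mul_polyC scaleNr.
apply: le_trans (wnormD _ _ t0) _.
by rewrite wnormMX wnormZ normcN mulrDl addrC.
Qed.

Lemma normc_prod (I : Type) (s : seq I) (F : I -> C) :
  normc (\prod_(i <- s) F i) = \prod_(i <- s) normc (F i).
Proof.
elim: s => [|x s IH]; first by rewrite !big_nil normc1.
by rewrite !big_cons normcM IH.
Qed.

Lemma normcX (z : C) n : normc (z ^+ n) = normc z ^+ n.
Proof. by elim: n => [|n IH]; rewrite ?normc1 // !exprS normcM IH. Qed.

Lemma normc_sum (I : Type) (s : seq I) (F : I -> C) :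
  normc (\sum_(i <- s) F i) <= \sum_(i <- s) normc (F i).
Proof.
elim: s => [|x s IH]; first by rewrite !big_nil normc0.
by rewrite !big_cons; apply: le_trans (le_normcD _ _) _; rewrite lerD2l.
Qed.

Lemma horner_le_wnorm p z : normc p.[z] <= wnorm (normc z) p.
Proof.
rewrite horner_coef; apply: le_trans (normc_sum _ _) _.
by apply: ler_sum => i _; rewrite normcM normcX.
Qed.

Lemma wnorm_le (t u : R) p : 0 <= t -> t <= u -> wnorm t p <= wnorm u p.
Proof.
move=> t0 tu; apply: ler_sum => i _; rewrite ler_wpM2l ?normc_ge0 //.
by rewrite lerXn2r // nnegrE // (le_trans t0).
Qed.

Lemma wnorm_le_expr t p k : 1 <= t -> (size p <= k.+1)%N -> wnorm t p <= t ^+ k * wnorm 1 p.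
Proof.
move=> t1 sp; rewrite mulr_sumr; apply: ler_sum => i _.
rewrite expr1n mulr1 mulrC ler_wpM2r ?normc_ge0 // ler_weXn2l //.
by rewrite -ltnS (leq_trans (ltn_ord i)).
Qed.

Lemma wnorm_prod_XsubC t c (s : seq C) : 0 <= t ->
  wnorm t (c *: \prod_(b <- s) ('X - b%:P)) <= normc c * \prod_(b <- s) (normc b + t).
Proof.
move=> t0; rewrite wnormZ ler_wpM2l ?normc_ge0 //; elim: s => [|b s IH].
  by rewrite !big_nil -polyC1 wnormC normc1.
rewrite !big_cons mulrC; apply: le_trans (wnormM_XsubC _ _ t0) _.
by rewrite ler_wpM2l // addr_ge0 ?normc_ge0.
Qed.

Lemma wnorm_eq0 p : wnorm 1 p = 0 -> p = 0.
Proof.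
move=> h; apply/polyP => i; rewrite coef0; apply: eq0_normc; apply/eqP.
rewrite eq_le normc_ge0 andbT -h.
by have := @coef_le_wnorm 1 p i ler01; rewrite expr1n mulr1.
Qed.

Lemma poly_linear_factors p : p != 0 ->
  {s : seq C | p = lead_coef p *: \prod_(b <- s) ('X - b%:P) & size s = (size p).-1}.
Proof.
move=> p0; have [s hs] := closed_field_poly_normal p; exists s => //.
by rewrite {1}hs size_scale ?lead_coef_eq0 // size_prod_XsubC.
Qed.

Lemma root_linear_factors p s b :
  p = lead_coef p *: \prod_(b <- s) ('X - b%:P) -> b \in s -> root p b.
Proof.
move=> -> bs; case: (eqVneq (lead_coef p) 0) => [->|h].
  by rewrite scale0r root0.
by rewrite rootZ // root_prod_XsubC.
Qed.

(** [wnorm tau] is submultiplicative over the factors [X - b], and a root with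
    [tau <= |b|] contributes [|b| + tau <= 2 |b|]; the product of the [|b|] is the
    modulus of the constant coefficient. *)
Lemma wnorm_le_coef0 (tau : R) p k : 0 < tau -> (size p <= k.+1)%N ->
  (forall b, root p b -> tau <= normc b) -> wnorm tau p <= 2 ^+ k * normc p`_0.
Proof.
move=> t0 sp hr; have [->|p0] := eqVneq p 0.
  by rewrite /wnorm size_poly0 big_ord0 coef0 normc0 mulr0.
have [s hs ss] := poly_linear_factors p0.
have hb b : b \in s -> tau <= normc b by move/(root_linear_factors hs)/hr.
rewrite {1}hs; apply: le_trans (wnorm_prod_XsubC _ _ (ltW t0)) _.
have -> : normc p`_0 = normc (lead_coef p) * \prod_(b <- s) normc b.
  rewrite -horner_coef0 {1}hs hornerZ normcM horner_prod normc_prod; congr (_ * _).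
  by apply: eq_bigr => b _; rewrite hornerXsubC sub0r normcN.
rewrite mulrCA ler_wpM2l ?normc_ge0 //.
apply: (@le_trans _ _ (2 ^+ size s * \prod_(b <- s) normc b)); last first.
  rewrite ler_wpM2r ?prodr_ge0 // => [b _|]; first exact: normc_ge0.
  by rewrite ler_weXn2l ?ler1n // ss -ltnS (leq_trans _ sp) // ltn_predL size_poly_gt0.
elim: s hb {hs ss} => [|b s IH] hb; first by rewrite !big_nil expr0 mulr1.
rewrite !big_cons /= exprS mulrACA ler_pM //.
- by rewrite addr_ge0 ?normc_ge0 // ltW.
- by rewrite prodr_ge0 // => c _; rewrite addr_ge0 ?normc_ge0 // ltW.
- by have := hb b (mem_head _ _); lra.
by apply: IH => c cs; rewrite hb // in_cons cs orbT.
Qed.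

(** The points of [s] are avoided one after the other: one of the two outer thirds
    of the current interval is at distance at least a sixth of its length from
    the next point. *)
Lemma radius_away_from (s : seq R) (a b : R) : a < b ->
  exists2 r, a < r < b & forall x, x \in s -> (b - a) / (6 * 3 ^+ size s) <= `|r - x|.
Proof.
elim: s a b => [|x s IH] a b ab.
  by exists ((a + b) / 2) => //; lra.
have e3 : 1 <= (3 : R) ^+ size s by rewrite exprn_ege1 // ler1n.
have H a' b' : a <= a' -> b' <= b -> b' - a' = (b - a) / 3 ->
    (forall r, a' < r < b' -> (b - a) / 6 <= `|r - x|) ->
    exists2 r, a < r < b & forall y, y \in x :: s ->
      (b - a) / (6 * 3 ^+ size (x :: s)) <= `|r - y|.
  move=> aa bb e Hx; have [|r /andP[r1 r2] hr] := IH a' b'; first by lra.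
  exists r; first lra; move=> y; rewrite in_cons => /orP[/eqP->|ys].
    apply: le_trans (Hx r _); last by rewrite r1.
    rewrite ler_pM2l ?subr_gt0 // lef_pV2 ?posrE ?mulr_gt0 ?exprn_gt0 //.
    by rewrite ler_peMr // exprn_ege1 // ler1n.
  apply: le_trans (hr y ys); rewrite e /= exprS.
  by rewrite le_eqVlt; apply/orP; left; apply/eqP; field; apply/eqP; lra.
have [hx|hx] := leP x ((a + b) / 2).
  apply: (H (a + 2 * (b - a) / 3) b) => //; try lra.
  by move=> r hr; rewrite ger0_norm; lra.
apply: (H a (a + (b - a) / 3)) => //; try lra.
by move=> r hr; rewrite ltr0_norm; lra.
Qed.

(** Root by root: [|z - b|] is at least [delta] and at least [|b| - rho], so it is
    at least a constant times [1 + |b|], the contribution of [b] to [wnorm 1 p]. *)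
Lemma wnorm_le_horner (delta rho : R) p z k : 0 < delta -> normc z <= rho ->
  (size p <= k.+1)%N ->
  (forall b, root p b -> delta <= `|normc z - normc b|) ->
  (delta / (1 + rho + delta)) ^+ k * wnorm 1 p <= normc p.[z].
Proof.
move=> d0 zr sp hr; have [->|p0] := eqVneq p 0.
  by rewrite /wnorm size_poly0 big_ord0 mulr0 normc_ge0.
have rho0 : 0 <= rho by rewrite (le_trans (normc_ge0 z)).
set c := _ / _; have c0 : 0 < c by rewrite divr_gt0 //; lra.
have c1 : c <= 1 by rewrite ler_pdivrMr; lra.
have [s hs ss] := poly_linear_factors p0.
have hb b : b \in s -> c * (normc b + 1) <= normc (z - b).
  move/(root_linear_factors hs)/hr => h.
  have t1 : normc z <= normc (z - b) + normc b.
    by rewrite -{1}(subrK b z) le_normcD.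
  have t2 : normc b <= normc (z - b) + normc z.
    by rewrite addrC -{1}(subKr z b) le_normcB.
  have h1 : delta <= normc (z - b).
    by apply: le_trans h _; rewrite ler_norml; lra.
  rewrite /c mulrAC ler_pdivrMr; last lra.
  have : delta * (normc b - rho) <= delta * normc (z - b) by rewrite ler_pM2l //; lra.
  have : delta * (1 + rho) <= normc (z - b) * (1 + rho) by rewrite ler_pM2r //; lra.
  lra.
have -> : normc p.[z] = normc (lead_coef p) * \prod_(b <- s) normc (z - b).
  rewrite {1}hs hornerZ normcM horner_prod normc_prod; congr (_ * _).
  by apply: eq_bigr => b _; rewrite hornerXsubC.
have := wnorm_prod_XsubC (lead_coef p) s (@ler01 R); rewrite -hs => hw.
apply: le_trans (_ : c ^+ size s * wnorm 1 p <= _).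
  rewrite ler_wpM2r ?wnorm_ge0 ?ler01 // ler_wiXn2l ?(ltW c0) // ss.
  by rewrite -ltnS (leq_trans _ sp) // ltn_predL size_poly_gt0.
apply: (@le_trans _ _ (c ^+ size s * (normc (lead_coef p) * \prod_(b <- s) (normc b + 1)))).
  by rewrite ler_wpM2l // exprn_ge0 // ltW.
rewrite mulrCA ler_wpM2l ?normc_ge0 //.
elim: s hb {hs ss hw} => [|b s IH] hb; first by rewrite !big_nil expr0 mulr1.
rewrite !big_cons /= exprS mulrACA ler_pM //.
- by rewrite mulr_ge0 ?(ltW c0) // addr_ge0 ?normc_ge0.
- by rewrite mulr_ge0 ?exprn_ge0 ?(ltW c0) // prodr_ge0 // => d _; rewrite addr_ge0 ?normc_ge0.
- exact: hb (mem_head _ _).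
by apply: IH => d ds; rewrite hb // in_cons ds orbT.
Qed.

(** There are at most [k] roots for each of the [k + 1] coefficients, so their
    moduli can be avoided at a distance that depends on [k], [a] and [b] only. *)
Lemma exists_good_circle k (a b : R) : 0 <= a -> a < b ->
  exists2 c : R, 0 < c & forall S : {poly {poly C}}, (size S <= k.+1)%N ->
    (forall j, (size (S`_j)%R <= k.+1)%N) ->
    exists2 r, a < r < b & forall j z, normc z = r ->
      c * wnorm 1 S`_j <= normc (S`_j).[z].
Proof.
move=> a0 ab; set n := (k.+1 * k)%N.
set delta := (b - a) / (6 * 3 ^+ n).
have d0 : 0 < delta by rewrite divr_gt0 ?subr_gt0 // mulr_gt0 ?exprn_gt0.
exists ((delta / (1 + b + delta)) ^+ k).
  by rewrite exprn_gt0 // divr_gt0 //; lra.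
move=> S sS sSj.
have [rs hrs srs] : exists2 rs : seq R, (forall j z, S`_j != 0 -> root S`_j z -> normc z \in rs) & (size rs <= n)%N.
  suff [rs hrs srs] : exists2 rs : seq R, (forall j z, (j < size S)%N -> S`_j != 0 ->
      root S`_j z -> normc z \in rs) & (size rs <= size S * k)%N.
    exists rs; last by rewrite (leq_trans srs) // leq_mul2r sS orbT.
    move=> j z Sj0; apply: hrs => //; rewrite ltnNge; apply: contra Sj0 => h.
    by rewrite nth_default.
  elim: (size S) => [|m [rs h1 h2]]; first by exists [::].
  have [e|Sm0] := eqVneq S`_m 0.
    exists rs; last by rewrite (leq_trans h2) // leq_mul2r leqnSn orbT.
    move=> j z; rewrite ltnS leq_eqVlt => /orP[/eqP->|]; first by rewrite e eqxx.
    exact: h1.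
  have [s hs ss] := poly_linear_factors Sm0.
  exists ([seq normc b | b <- s] ++ rs).
    move=> j z; rewrite mem_cat ltnS leq_eqVlt => /orP[/eqP->|jm] Sj0 rz.
      apply/orP; left; apply: map_f; move: rz; rewrite {1}hs rootZ ?lead_coef_eq0 //.
      by rewrite root_prod_XsubC.
    by rewrite (h1 _ _ jm Sj0 rz) orbT.
  rewrite size_cat size_map mulSn leq_add // ss.
  by have := sSj m; case: (size _).
have [r /andP[r1 r2] hr] := radius_away_from rs ab; exists r; first by rewrite r1.
move=> j z ez; have [->|Sj0] := eqVneq S`_j 0.
  by rewrite /wnorm size_poly0 big_ord0 mulr0 normc_ge0.
apply: wnorm_le_horner => //; first by rewrite ez ltW.
move=> z' rz'; rewrite ez; apply: le_trans (hr _ (hrs _ _ Sj0 rz')).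
rewrite /delta ler_pM2l ?subr_gt0 // lef_pV2 ?posrE ?mulr_gt0 ?exprn_gt0 //.
by rewrite ler_pM2l // ler_weXn2l // ler1n.
Qed.

(** Newton interpolation, one node at a time: [p = (X - x) q + p(x)], where
    the divided differences [q(y) = (p(y) - p(x)) / (y - x)] are bounded at the
    remaining nodes. *)
Lemma interpolation_bound (xs : seq C) : uniq xs -> exists2 L : R, 0 <= L &
  forall p (s : R), (size p <= size xs)%N -> (forall x, x \in xs -> normc p.[x] <= s) ->
  wnorm 1 p <= L * s.
Proof.
elim: xs => [|x xs IH] /=.
  move=> _; exists 0 => // p s; rewrite leqn0 size_poly_eq0 => /eqP-> _.
  by rewrite /wnorm size_poly0 big_ord0 mul0r.
move=> /andP[xxs /IH[L L0 HL]].
set D := \sum_(y <- xs) (normc (y - x))^-1.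
have D0 : 0 <= D by apply: sumr_ge0 => y _; rewrite invr_ge0 normc_ge0.
exists (1 + (normc x + 1) * (L * (D * 2))).
  by rewrite addr_ge0 // !mulr_ge0 // addr_ge0 ?normc_ge0.
move=> p s sp hs.
have px := hs x (mem_head _ _).
have s0 : 0 <= s by apply: le_trans px; exact: normc_ge0.
have /factor_theorem[q hq] : root (p - p.[x]%:P) x.
  by rewrite /root !hornerE subrr.
have ep : p = q * ('X - x%:P) + p.[x]%:P by rewrite -hq subrK.
have sq : (size q <= size xs)%N.
  have [->|q0] := eqVneq q 0; first by rewrite size_poly0.
  have : (size (p - p.[x]%:P)%R <= (size xs).+1)%N.
    rewrite (leq_trans (size_polyD _ _)) // geq_max sp size_polyN.
    by rewrite (leq_trans (size_polyC_leq1 _)).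
  by rewrite hq size_Mmonic ?monicXsubC // size_XsubC addn2.
rewrite {1}ep; apply: le_trans (wnormD _ _ ler01) _; rewrite wnormC.
rewrite mulrDl mul1r addrC lerD //.
apply: le_trans (wnormM_XsubC _ _ ler01) _.
rewrite -mulrA ler_wpM2l ?addr_ge0 ?normc_ge0 // -mulrA.
apply: HL => // y yxs.
have yx : y - x != 0 by rewrite subr_eq0; apply: contraNneq xxs => <-.
have nyx : 0 < normc (y - x).
  by rewrite lt_neqAle normc_ge0 andbT eq_sym; apply: contra yx => /eqP/eq0_normc->.
have : normc (q.[y]) * normc (y - x) <= 2 * s.
  rewrite -normcM; have -> : q.[y] * (y - x) = p.[y] - p.[x].
    by rewrite {1}ep !hornerE addrK.
  have := hs y _; rewrite in_cons yxs orbT => /(_ isT) => h.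
  by apply: le_trans (le_normcB _ _) _; lra.
rewrite -ler_pdivlMr // => h; apply: le_trans h _.
rewrite mulrC -mulrA ler_wpM2r ?mulr_ge0 //.
rewrite /D (big_rem y) //= lerDl sumr_ge0 // => w _.
by rewrite invr_ge0 normc_ge0.
Qed.

End CoefficientNorms.

(** * Polynomials in two variables *)

Section BivariatePolynomials.
Variable R : realType.
Local Notation C := R[i].
Implicit Types (S T : {poly {poly C}}).

(** The outer variable of [S] is [w] and its coefficients are polynomials in [z]. *)
Definition eval2 S (z w : C) : C := S.[w%:P].[z].

Lemma eval2D S T z w : eval2 (S + T) z w = eval2 S z w + eval2 T z w.
Proof. by rewrite /eval2 !hornerD. Qed.
Lemma eval2M S T z w : eval2 (S * T) z w = eval2 S z w * eval2 T z w.
Proof. by rewrite /eval2 !hornerM. Qed.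
Lemma eval2C (c : {poly C}) z w : eval2 c%:P z w = c.[z].
Proof. by rewrite /eval2 hornerC. Qed.
Lemma eval2X z w : eval2 'X z w = w.
Proof. by rewrite /eval2 hornerX hornerC. Qed.
Lemma eval2Xn T z w n : eval2 (T ^+ n) z w = eval2 T z w ^+ n.
Proof. by rewrite /eval2 !horner_exp. Qed.
Lemma eval2Z (c : {poly C}) T z w : eval2 (c *: T) z w = c.[z] * eval2 T z w.
Proof. by rewrite /eval2 hornerZ hornerM. Qed.

Lemma eval2_coef S z w : eval2 S z w = \sum_(j < size S) (S`_j).[z] * w ^+ j.
Proof.
rewrite /eval2 (horner_coef S) horner_sum; apply: eq_bigr => j _.
by rewrite hornerM horner_exp hornerC.
Qed.

Lemma eval2_wide T k z w : (size T <= k.+1)%N ->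
  eval2 T z w = \sum_(j < k.+1) (T`_j).[z] * w ^+ j.
Proof.
move=> sT; rewrite eval2_coef (big_ord_widen k.+1 (fun i => (T`_i).[z] * w ^+ i) sT).
rewrite big_mkcond; apply: eq_bigr => i _; case: ltnP => // hi.
by rewrite nth_default // horner0 mul0r.
Qed.

Lemma deriv_neq0 T : (1 < size T)%N -> T^`() != 0.
Proof.
case: (ltnP 1 (size T)) => // sT _; apply/eqP.
move=> /(congr1 (fun p : {poly {poly C}} => p`_((size T).-2))).
have e : (size T).-2.+1 = (size T).-1 by case: (size T) sT => [|[|]].
rewrite coef_deriv coef0 e -/(lead_coef T) -scaler_nat.
move/eqP; rewrite scaler_eq0 pnatr_eq0 lead_coef_eq0.
have /negPf-> : T != 0 by rewrite -size_poly_gt0 (ltn_trans _ sT).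
by rewrite orbF; case: (size T) sT => [|[|]].
Qed.

Import Pdiv.Idomain.

(** A [T] of least degree in [w] with this property is squarefree: if [G ^+ 2]
    divided [T], say [c T = H G ^+ 2], then [H G] would do, as [(H G) ^+ 2] is a
    multiple of [T].  The factors [c] in [{poly C}] replace division in the
    field of rational functions of [z]. *)
Lemma exists_separable_power S : S != 0 ->
  exists T, separable_poly T /\
  exists N (c : {poly C}) X, c != 0 /\ c *: T ^+ N = X * S.
Proof.
move=> S0; suff H n T : (size T <= n)%N -> T != 0 ->
  (exists N (c : {poly C}) X, c != 0 /\ c *: T ^+ N = X * S) ->
  exists T, separable_poly T /\
    exists N (c : {poly C}) X, c != 0 /\ c *: T ^+ N = X * S.
  by apply: (H _ S (leqnn _) S0); exists 1%N, 1, 1; rewrite oner_eq0 scale1r expr1 mul1r.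
elim: n T => [|n IH] T sT T0 hT.
  by move: sT; rewrite leqn0 size_poly_eq0 (negPf T0).
have [sepT|nsepT] := boolP (separable_poly T); first by exists T.
have [u [v [uvT cuv]]] : exists u v : {poly {poly C}}, (u * v %| T) /\ ~~ coprimep u v.
  apply: contrapT => hn; move/negP: nsepT; apply; apply/separable_polyP; split.
    by move=> u v uvT; apply: contrapT => /negP cuv; apply: hn; exists u, v.
  by move=> u _; exact: deriv_neq0.
set G := gcdp u v.
have GGT : G * G %| T.
  by apply: dvdp_trans uvT; rewrite dvdp_mul ?dvdp_gcdl ?dvdp_gcdr.
have /Pdiv.WeakIdomain.dvdpP[[c H] /= c0 e] := GGT.
have cT0 : c *: T != 0 by rewrite scale_poly_eq0 negb_or c0.
have HGG0 : H * (G * G) != 0 by rewrite -e.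
have [H0 G0] : H != 0 /\ G != 0.
  by move: HGG0; rewrite !mulf_eq0 !negb_or => /and3P[-> -> _].
have sG : (1 < size G)%N.
  rewrite ltn_neqAle eq_sym size_poly_gt0 G0 andbT.
  by move: cuv; rewrite coprimep_def.
apply: (IH (H * G)); last first.
- have [N [d [X [d0 eX]]]] := hT.
  exists (2 * N)%N, d, (c ^+ N *: (H ^+ N * X)); split=> //.
  rewrite exprM -scalerAl -mulrA -eX.
  have -> : (H * G) ^+ 2 = c *: (H * T) by rewrite scalerAr e; ring.
  by rewrite exprZn exprMn -scalerAr !scalerA mulrC.
- by rewrite mulf_neq0.
rewrite -ltnS; apply: leq_trans sT.
have : size (c *: T) = size T by rewrite size_scale.
rewrite e mulrA size_mul ?mulf_neq0 // => <-.
rewrite (size_mul H0 G0).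
have := size_poly_gt0 H; rewrite H0.
by move: sG; case: (size G) => [|[|a]] //; case: (size H) => // b _ _; rewrite !addnS /= ltnS leq_addr.
Qed.

(** If [c T ^+ N] is a multiple of [S], the zeros of [S] at which [c] does not vanish
    are zeros of [T].  With [T] squarefree, Bezout for [T] and its derivative
    produces a nonzero polynomial in [z] alone; [q] is its product with [c]. *)
Lemma generic_simple_root S : S != 0 -> exists T (q : {poly C}), q != 0 /\
  forall z w, q.[z] != 0 -> eval2 S z w = 0 ->
  eval2 T z w = 0 /\ eval2 T^`() z w != 0.
Proof.
move=> S0; have [T [sepT [N [c [X [c0 eT]]]]]] := exists_separable_power S0.
have := sepT; rewrite unlock => /Bezout_coprimepP[[u v] /=].
rewrite eqp_sym => /eqpP[[d1 d2] /= /andP[d10 d20] e].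
exists T, (c * d1); split; first by rewrite mulf_neq0.
move=> z w; rewrite hornerM mulf_eq0 negb_or => /andP[cz dz] Sz.
have Tz : eval2 T z w = 0.
  have := congr1 (fun Q => eval2 Q z w) eT.
  rewrite eval2M Sz mulr0 eval2Z eval2Xn => /eqP; rewrite mulf_eq0 (negPf cz) /=.
  by rewrite expf_eq0 => /andP[_ /eqP].
split=> //; apply: contra dz => /eqP T'z.
have := congr1 (fun Q => eval2 Q z w) e.
rewrite !eval2Z eval2D !eval2M Tz T'z !mulr0 addr0 mulr0 -polyC1 eval2C hornerC mulr1.
by move=> ->.
Qed.

End BivariatePolynomials.

Section MpolyConversion.
Variable R : realType.
Local Notation C := R[i].
Import -(notations) mpoly.

Lemma peval_eval2 (S : mpoly 2 C) k : S <> 0 -> (msize S <= k.+1)%N ->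
  exists T : {poly {poly C}}, [/\ T != 0, (size T <= k.+1)%N,
    forall j, (size (T`_j)%R <= k.+1)%N & forall z w, peval S z w = eval2 T z w].
Proof.
move=> S0 sS.
have hd m : m \in msupp S -> (mdeg m < k.+1)%N.
  by move=> /msize_mdeg_lt h; apply: leq_trans sS.
have mE (m : multinom 2) : mdeg m = (m ord0 + m ord_max)%N.
  by rewrite mdegE (big_ord_recl 1%N) (big_ord_recl 0%N) big_ord0 addn0; congr (_ + m _)%N; apply: val_inj.
pose T : {poly {poly C}} :=
  \poly_(j < k.+1) \poly_(i < k.+1) (mcoeff (Multinom [tuple (if l == 0%N :> nat then i else j) | l < 2]) S).
have cT j i : T`_j`_i = mcoeff (Multinom [tuple (if l == 0%N :> nat then i else j) | l < 2]) S.
  rewrite coef_poly; case: ltnP => hj; last first.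
    rewrite coef0; apply/esym/memN_msupp_eq0; apply/negP => /hd.
    rewrite mE !mnmE /= => h.
    by have := leq_trans h hj; rewrite ltnNge leq_addl.
  rewrite coef_poly; case: ltnP => hi //.
  apply/esym/memN_msupp_eq0; apply/negP => /hd.
  rewrite mE !mnmE /= => h.
  by have := leq_trans h hi; rewrite ltnNge leq_addr.
have meq (m : multinom 2) : Multinom [tuple (if l == 0%N :> nat then m ord0 else m ord_max) | l < 2] = m.
  apply/mnmP => l; rewrite mnmE; case: ifP => /eqP hl; congr (m _); apply: val_inj => //=.
  by case: l hl => [[|[|]]].
exists T; split.
- apply/eqP => T0; apply: S0; apply/mpolyP => m.
  by rewrite mcoeff0 -(meq m) -cT T0 !coef0.
- exact: size_poly.
- by move=> j; rewrite coef_poly; case: ifP => _; rewrite ?size_poly0 // size_poly.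
move=> z w.
have mkE (m : multinom 2) i j :
    ((Multinom [tuple (if l == 0%N :> nat then i else j) | l < 2]) == m) = (i == m ord0) && (j == m ord_max).
  apply/eqP/andP => [<-|[/eqP-> /eqP->]]; first by rewrite !mnmE.
  exact: meq.
have -> : T = \sum_(m <- msupp S) ((mcoeff m S *: 'X^(m ord0))%:P * 'X^(m ord_max)).
  apply/polyP => j; apply/polyP => i; rewrite cT coef_sum coef_sum.
  have cE (m : multinom 2) : ((mcoeff m S *: 'X^(m ord0))%:P * 'X^(m ord_max))`_j`_i =
      mcoeff m S * ((Multinom [tuple (if l == 0%N :> nat then i else j) | l < 2]) == m)%:R.
    rewrite mkE coefCM coefXn; case: eqP => _; rewrite ?mulr1 ?mulr0 ?coef0 ?andbF ?mulr0 //.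
    by rewrite andbT coefZ coefXn.
  under eq_bigr do rewrite cE.
  set mu := Multinom _.
  have [hm|hm] := boolP (mu \in msupp S).
    rewrite (bigD1_seq mu) ?msupp_uniq //= eqxx mulr1 big1 ?addr0 // => m hmu.
    by rewrite eq_sym (negPf hmu) mulr0.
  rewrite (memN_msupp_eq0 hm) big_seq big1 // => m hmS.
  by case: eqP => [e|_]; rewrite ?mulr0 //; rewrite e hmS in hm.
rewrite /peval mevalE /eval2 !horner_sum; apply: eq_bigr => m _.
rewrite hornerCM hornerXn hornerM hornerZ hornerXn horner_exp hornerC -mulrA.
by rewrite (big_ord_recl 1%N) (big_ord_recl 0%N) big_ord0 mulr1; congr (_ * (_ * _ ^+ m _)); apply: val_inj.
Qed.

End MpolyConversion.

(** * Taylor expansions in the sense of Peano *)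

Section Jets.
Variable R : realType.
Local Notation C := (R[i]^o).
Implicit Types (f g : C -> C).

(** Taylor expansion of order [n] at [z0], as an iterated divided difference that is
    continuous at [z0]; the product and quotient rules are then identities. *)
Fixpoint jet n f (z0 : C) : Prop :=
  if n is m.+1 then exists2 phi : C -> C, jet m phi z0 &
    \forall z \near z0, f z = f z0 + (z - z0) * phi z
  else {for z0, continuous f}.

Lemma near_continuous f g (z0 : C) :
  (\forall z \near z0, f z = g z) -> {for z0, continuous g} -> {for z0, continuous f}.
Proof.
move=> fg cg; have e0 : f z0 = g z0 by exact: nbhs_singleton fg.
have H : g z @[z --> z0] --> f z0 by rewrite e0.
move=> P /H hP; have {hP} hP : \forall z \near z0, P (g z) by exact: hP.
by apply: filterS2 fg hP => z; rewrite /= => ->.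
Qed.

Lemma jet_near n f g (z0 : C) :
  (\forall z \near z0, f z = g z) -> jet n g z0 -> jet n f z0.
Proof.
case: n => [|n] fg /=; first exact: near_continuous.
move=> [phi jphi hphi]; exists phi => //.
have e0 : f z0 = g z0 by exact: nbhs_singleton fg.
by apply: filterS2 fg hphi => z -> ->; rewrite e0.
Qed.

Lemma jet_continuous n f z0 : jet n f z0 -> {for z0, continuous f}.
Proof.
case: n => [//|n]; elim: n f => [|n IH] f [phi jphi hphi];
  (have cphi : {for z0, continuous phi} by [exact: jphi|exact: IH jphi]);
  apply: (near_continuous hphi); (apply: continuousD; first exact: cst_continuous);
  (apply: continuousM; last exact: cphi);
  by apply: continuousB; [exact: cvg_id|exact: cst_continuous].
Qed.

Lemma jetW n f z0 : jet n.+1 f z0 -> jet n f z0.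
Proof.
elim: n f => [|n IH] f; first exact: (@jet_continuous 1).
by move=> [phi /IH jphi hphi]; exists phi.
Qed.

Lemma jet_cst n (c z0 : C) : jet n (fun=> c) z0.
Proof.
elim: n c => [|n IH] c /=; first exact: cst_continuous.
by exists (fun=> 0) => //; near=> z; rewrite mulr0 addr0.
Unshelve. all: by end_near. Qed.

Lemma jet_id n (z0 : C) : jet n id z0.
Proof.
case: n => [|n] /=; first exact: cvg_id.
by exists (fun=> 1); [exact: jet_cst|near=> z; rewrite mulr1 addrC subrK].
Unshelve. all: by end_near. Qed.

Lemma jetD n f g z0 : jet n f z0 -> jet n g z0 -> jet n (fun z => f z + g z) z0.
Proof.
elim: n f g => [|n IH] f g /=; first exact: continuousD.
move=> [phi jphi hphi] [psi jpsi hpsi]; exists (fun z => phi z + psi z); first exact: IH.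
apply: filterS2 hphi hpsi => z -> ->; ring.
Qed.

Lemma jetM n f g z0 : jet n f z0 -> jet n g z0 -> jet n (fun z => f z * g z) z0.
Proof.
elim: n f g => [|n IH] f g /=; first exact: continuousM.
move=> [phi jphi hphi] [psi jpsi hpsi].
have jg : jet n g z0 by apply: jetW; exists psi.
exists (fun z => phi z * g z + f z0 * psi z).
  by apply: jetD; apply: IH => //; exact: jet_cst.
apply: filterS2 hphi hpsi => z -> ->; ring.
Qed.

Lemma jetN n f z0 : jet n f z0 -> jet n (fun z => - f z) z0.
Proof.
move=> jf; apply: (@jet_near _ _ (fun z => (-1) * f z)).
  by near=> z; rewrite mulN1r.
by apply: jetM => //; exact: jet_cst.
Unshelve. all: by end_near. Qed.

Lemma jetX n m f z0 : jet n f z0 -> jet n (fun z => f z ^+ m) z0.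
Proof.
move=> jf; elim: m => [|m IH]; first exact: jet_cst.
apply: (@jet_near _ _ (fun z => f z * f z ^+ m)); last exact: jetM.
by near=> z; rewrite exprS.
Unshelve. all: by end_near. Qed.

Lemma near_neq0 f (z0 : C) : {for z0, continuous f} -> f z0 != 0 ->
  \forall z \near z0, f z != 0.
Proof.
move=> cf f0; have /continuous_normcP H := cf.
have n0 : 0 < normc (f z0).
  by rewrite lt_neqAle normc_ge0 andbT eq_sym; apply: contra f0 => /eqP/eq0_normc->.
have /near_normcP[d d0 hd] := H _ n0; apply/near_normcP; exists d => // z /hd.
by apply: contraTneq => ->; rewrite sub0r normcN ltxx.
Qed.

Lemma jetV n f z0 : jet n f z0 -> f z0 != 0 -> jet n (fun z => (f z)^-1) z0.
Proof.
move=> jf f0; elim: n jf => [|n IH] jf; first exact: continuousV.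
have [phi jphi hphi] := jf; have jfn := jetW jf.
exists (fun z => - (phi z * (f z)^-1 * (f z0)^-1)).
  by apply: jetN; apply: jetM; [apply: jetM => //; exact: IH|exact: jet_cst].
have nf := near_neq0 (jet_continuous jf) f0.
apply: filterS2 hphi nf => z e fz.
have -> : (z - z0) * - (phi z * (f z)^-1 * (f z0)^-1) = - (((z - z0) * phi z) / f z / f z0) by ring.
have -> : (z - z0) * phi z = f z - f z0 by rewrite e; ring.
by field; rewrite fz f0.
Qed.

Lemma jet_horner n (p : {poly R[i]}) z0 : jet n (fun z => p.[z] : C) z0.
Proof.
elim/poly_ind: p => [|p c IH].
  apply: (@jet_near _ _ (fun=> 0)); last exact: jet_cst.
  by near=> z; rewrite horner0.
apply: (@jet_near _ _ (fun z => p.[z] * z + c)).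
  by near=> z; rewrite !hornerE.
by apply: jetD; [apply: jetM => //; exact: jet_id|exact: jet_cst].
Unshelve. all: by end_near. Qed.

Lemma jet_eval2 n (T : {poly {poly R[i]}}) f z0 : jet n f z0 ->
  jet n (fun z => eval2 T z (f z) : C) z0.
Proof.
move=> jf; elim/poly_ind: T => [|T c IH].
  apply: (@jet_near _ _ (fun=> 0)); last exact: jet_cst.
  by near=> z; rewrite /eval2 !horner0.
apply: (@jet_near _ _ (fun z => eval2 T z (f z) * f z + c.[z])).
  by near=> z; rewrite eval2D eval2M eval2X eval2C.
by apply: jetD; [apply: jetM|exact: jet_horner].
Unshelve. all: by end_near. Qed.

(** Dividing [T(z, w) - T(z0, w0)] by [w - w0] and then by [z - z0] turns the
    equation into [f z - w0 = - (z - z0) W(z) / U(z, f z)], where [U(z0, w0)] is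
    the derivative.  The factor of [z - z0] is a rational function of [z] and
    [f z], so it is as regular as [f], and [f] gains one order at each step. *)
Lemma jet_implicit n (T : {poly {poly R[i]}}) f (z0 : C) :
  {for z0, continuous f} -> (\forall z \near z0, eval2 T z (f z) = 0) ->
  eval2 T^`() z0 (f z0) != 0 -> jet n f z0.
Proof.
move=> cf Tf T'0; set w0 := f z0.
have T0 : eval2 T z0 w0 = 0 by exact: nbhs_singleton Tf.
have /factor_theorem[U hU] : root (T - (T.[w0%:P])%:P) w0%:P.
  by rewrite /root !hornerE subrr.
have /factor_theorem[W hW] : root T.[w0%:P] z0 by rewrite /root; apply/eqP; exact: T0.
have eT z w : eval2 T z w = eval2 U z w * (w - w0) + W.[z] * (z - z0).
  rewrite -{1}(subrK (T.[w0%:P])%:P T) hU eval2D eval2M eval2C hW.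
  by rewrite -[eval2 ('X - _) z w]/(_) /eval2 !hornerE.
have U0 : eval2 U z0 w0 = eval2 T^`() z0 w0.
  rewrite -{1}(subrK (T.[w0%:P])%:P T) hU derivD derivC addr0 derivM derivXsubC mulr1.
  by rewrite eval2D eval2M /eval2 !hornerE subrr !hornerE.
have jU m : jet m f z0 -> jet m (fun z => - (W.[z] / eval2 U z (f z))) z0.
  move=> jf; apply: jetN; apply: jetM; first exact: jet_horner.
  by apply: jetV; [exact: jet_eval2|rewrite U0].
elim: n => [//|n IH]; exists (fun z => - (W.[z] / eval2 U z (f z))); first exact: jU.
have : \forall z \near z0, eval2 U z (f z) != 0.
  by apply: near_neq0; [exact: (@jet_continuous 0 _ _ (jet_eval2 (n := 0) U cf))|rewrite U0].
apply: filterS2 Tf => z; rewrite eT => e nU.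
apply: (mulfI nU); rewrite mulrDr -/w0.
have -> : eval2 U z (f z) * ((z - z0) * - (W.[z] / eval2 U z (f z))) = - (W.[z] * (z - z0)).
  by field.
by apply/eqP; rewrite -subr_eq0 -e; apply/eqP; ring.
Qed.

End Jets.

Section JetsHaveNoMaximum.
Variable R : realType.
Local Notation C := (R[i]^o).
Implicit Types (f g F : C -> C).

Lemma normc_sqr (z : R[i]) : normc z ^+ 2 = complex.Re z ^+ 2 + complex.Im z ^+ 2.
Proof. by case: z => a b; rewrite sqr_sqrtr // addr_ge0 ?sqr_ge0. Qed.

Lemma normc_real (t : R) : 0 <= t -> normc t%:C = t.
Proof. by move=> t0; rewrite /normc /= expr0n /= addr0 sqrtr_sqr ger0_norm. Qed.

Lemma normc_i : normc ('i%C : R[i]) = 1.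
Proof. by rewrite /normc /= expr0n /= add0r expr1n sqrtr1. Qed.

(** Parseval for the four fourth roots of unity. *)
Lemma parallelogram4 (A a b : R[i]) (t : R) :
  let X (w : R[i]) := normc (A + w * t%:C * (a + w * t%:C * b)) ^+ 2 in
  X 1 + X (-1) + X 'i + X (- 'i) =
  4 * (normc A ^+ 2 + t ^+ 2 * normc a ^+ 2 + t ^+ 4 * normc b ^+ 2).
Proof.
rewrite /= !normc_sqr; case: A => A1 A2; case: a => a1 a2; case: b => b1 b2 /=.
by ring.
Qed.

(** Average over the points [z1 + w t] with [w ^+ 4 = 1] and [t] small.  By Parseval
    the mean of [|F|^2] is at least [|F z1|^2] up to [o(t ^+ 2)], while that of
    [delta |z|^2] exceeds its value at [z1] by [delta t ^+ 2]. *)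
Lemma jet2_no_max F (z1 : C) (delta : R) : 0 < delta -> jet 2 F z1 ->
  (\forall z \near z1, normc (F z) ^+ 2 + delta * normc z ^+ 2 <=
     normc (F z1) ^+ 2 + delta * normc z1 ^+ 2) -> False.
Proof.
move=> d0 [phi [psi cpsi hpsi] hphi] hmax.
set A := F z1 in hphi hmax *; set a := phi z1 in hpsi; set b := psi z1.
set B := normc A + normc a + normc b.
have B0 : 0 <= B by rewrite !addr_ge0 ?normc_ge0.
set eps := delta / (2 * (B + 1)).
have eps0 : 0 < eps by rewrite divr_gt0 // mulr_gt0 //; lra.
have /continuous_normcP /(_ _ eps0) hc := cpsi.
have {hpsi hphi hmax hc} /near_normcP[r r0 hr] : \forall z \near z1,
  [/\ F z = A + (z - z1) * (a + (z - z1) * psi z), normc (psi z - b) < eps &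
    normc (F z) ^+ 2 + delta * normc z ^+ 2 <= normc A ^+ 2 + delta * normc z1 ^+ 2].
  have h1 : \forall z \near z1, F z = A + (z - z1) * (a + (z - z1) * psi z).
    by apply: filterS2 hphi hpsi => z -> <-.
  by apply: filterS3 h1 hc hmax => z.
set t := Num.min 1 (r / 2).
have t0 : 0 < t by rewrite lt_min ltr01 divr_gt0.
have t1 : t <= 1 by rewrite ge_min lexx.
have tr : t < r by rewrite gt_min; apply/orP; right; lra.
pose Y (w : R[i]) := normc (A + w * t%:C * (a + w * t%:C * b)) ^+ 2.
pose Z (w : R[i]) := normc (z1 + w * t%:C * (1 + w * t%:C * 0)) ^+ 2.
have H (w : R[i]) : normc w = 1 -> Y w - 2 * B * (eps * t ^+ 2) + delta * Z w <=
    normc A ^+ 2 + delta * normc z1 ^+ 2.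
  move=> w1; have nwt : normc (w * t%:C) = t by rewrite normcM w1 mul1r normc_real // ltW.
  have := hr (z1 + w * t%:C); rewrite addrAC subrr add0r nwt => /(_ tr)[eF he].
  rewrite /Y /Z eF mulr0 addr0 mulr1; apply: le_trans; rewrite lerD2r.
  set X := A + w * t%:C * (a + w * t%:C * b); set e := psi _ in he *.
  have -> : A + w * t%:C * (a + w * t%:C * e) = X + (w * t%:C) ^+ 2 * (e - b).
    by rewrite /X; ring.
  set E := _ * (e - b).
  have nE : normc E <= eps * t ^+ 2.
    by rewrite /E normcM normcX nwt mulrC ler_wpM2r ?exprn_ge0 ?(ltW t0) // ltW.
  have nX : normc X <= B.
    rewrite /X; apply: le_trans (le_normcD _ _) _; rewrite /B -addrA lerD2l.
    rewrite normcM nwt; apply: le_trans (_ : normc (a + w * t%:C * b) <= _).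
      by rewrite ler_piMl ?normc_ge0.
    apply: le_trans (le_normcD _ _) _; rewrite lerD2l normcM nwt.
    by rewrite ler_piMl ?normc_ge0.
  have nXE : normc X <= normc (X + E) + normc E.
    by rewrite -{1}(addrK E X) le_normcB.
  have h0 := normc_ge0 X; have h1 := normc_ge0 E; have h2 := normc_ge0 (X + E).
  have h3 : normc X * normc E <= B * (eps * t ^+ 2) by apply: ler_pM.
  have [h4|h4] := leP (normc E) (normc X); nra.
have e1 : Y 1 + Y (-1) + Y 'i%C + Y (- 'i%C) =
    4 * (normc A ^+ 2 + t ^+ 2 * normc a ^+ 2 + t ^+ 4 * normc b ^+ 2) by exact: parallelogram4.
have e2 : Z 1 + Z (-1) + Z 'i%C + Z (- 'i%C) = 4 * (normc z1 ^+ 2 + t ^+ 2).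
  rewrite [LHS](parallelogram4 z1 1 0 t : Z 1 + Z (-1) + Z 'i%C + Z (- 'i%C) = _).
  by rewrite normc1 normc0 expr1n mulr1 expr0n mulr0 addr0.
have nN (x : R[i]) : normc (- x) = normc x by exact: normcN.
have := H 1 (normc1 _); have := H (-1); rewrite nN normc1 => /(_ erefl).
have := H 'i%C normc_i; have := H (- 'i%C); rewrite nN normc_i => /(_ erefl).
have h1 : 0 <= t ^+ 2 * normc a ^+ 2 by rewrite mulr_ge0 // exprn_ge0 ?normc_ge0 // ltW.
have h2 : 0 <= t ^+ 4 * normc b ^+ 2 by rewrite mulr_ge0 // exprn_ge0 ?normc_ge0 // ltW.
have h3 : 2 * B * (eps * t ^+ 2) < delta * t ^+ 2.
  rewrite mulrA ltr_pM2r ?exprn_gt0 // /eps mulrA ltr_pdivrMr; last by rewrite mulr_gt0 //; lra.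
  nra.
have e3 : delta * Z 1 + delta * Z (-1) + delta * Z 'i%C + delta * Z (- 'i%C)
   = 4 * (delta * normc z1 ^+ 2) + 4 * (delta * t ^+ 2) by rewrite -!mulrDr e2; ring.
lra.
Qed.

End JetsHaveNoMaximum.

(** * The maximum principle off finitely many points *)

Section MaximumPrinciple.
Variable R : realType.
Local Notation C := (R[i]^o).
Implicit Types (f g F : C -> C).

Lemma normcB_le (x y : R[i]) : `|normc x - normc y| <= normc (x - y).
Proof.
have h1 : normc x <= normc (x - y) + normc y by rewrite -{1}(subrK y x) le_normcD.
have h2 : normc y <= normc (x - y) + normc x.
  by rewrite addrC -{1}(subKr x y) le_normcB.
by rewrite ler_norml; lra.
Qed.

Lemma normc_continuous : continuous (fun z : C => normc z : R).
Proof.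
move=> z P /nbhs_ballP[e e0 he]; apply/near_normcP; exists e => // w hw.
apply: he; rewrite /ball /=; apply: le_lt_trans (normcB_le _ _) _.
by rewrite -normcN opprB.
Qed.

Lemma continuous_normc_comp f (z : C) : {for z, continuous f} ->
  {for z, continuous (fun w => normc (f w) : R)}.
Proof. by move=> cf; apply: (continuous_comp cf); exact: normc_continuous. Qed.

Lemma real_complex_continuous : continuous (fun x : R => x%:C : C).
Proof.
move=> x P /near_normcP[d d0 hd].
have : \forall y \near x, `|x - y| < d by exact: (@cvgr_dist_lt _ _ _ (nbhs x) _ id x _ d d0).
apply: filterS => y hy; apply: hd; rewrite -rmorphB /=.
by rewrite /normc /= expr0n /= addr0 sqrtr_sqr distrC.
Qed.

Definition closed_disk (r : R) : set C := [set z | normc z <= r].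

Lemma closed_disk_closed r : closed (closed_disk r).
Proof.
by apply: (@closed_comp _ _ (fun z : C => normc z : R) [set x | x <= r]);
  [move=> ? _; exact: normc_continuous|exact: closed_le].
Qed.

Lemma closed_disk_compact r : compact (closed_disk r).
Proof.
pose h (p : R * R) : C := p.1%:C + 'i%C * p.2%:C.
have ch : continuous h.
  move=> p; apply: (@continuousD _ _ _ (fun p : R * R => p.1%:C : C) (fun p => 'i%C * p.2%:C : C)).
    by apply: continuous_comp; [exact: cvg_fst|exact: real_complex_continuous].
  apply: (@continuousM _ _ (fun=> 'i%C) (fun p : R * R => p.2%:C : C)).
    exact: cst_continuous.
  by apply: continuous_comp; [exact: cvg_snd|exact: real_complex_continuous].
have cS : compact (h @` (`[- r, r] `*` `[- r, r])).
  apply: continuous_compact; first exact: continuous_subspaceT.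
  by apply: compact_setX; exact: segment_compact.
apply: (subclosed_compact _ cS); first exact: closed_disk_closed.
move=> z hz; exists (complex.Re z, complex.Im z); last first.
  by rewrite /h /=; case: z {hz} => a b /=; apply/eqP; rewrite eq_complex /=; apply/andP; split; apply/eqP; ring.
have r0 : 0 <= r by apply: le_trans hz; exact: normc_ge0.
have : normc z ^+ 2 <= r ^+ 2 by rewrite lerXn2r // nnegrE ?normc_ge0.
rewrite normc_sqr => h1.
have := sqr_ge0 (complex.Re z); have := sqr_ge0 (complex.Im z) => h2 h3.
by split; rewrite /= in_itv /=; apply/andP; split; nra.
Qed.

Lemma max_on_compact (A : set C) (g : C -> R) : compact A -> A !=set0 ->
  (forall z, A z -> {for z, continuous g}) ->
  exists2 z1, A z1 & forall z, A z -> g z <= g z1.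
Proof.
move=> cA A0 cg; have [|c cin hc] := compact_EVT_max A0 cA (f := g).
  by apply: continuous_in_subspaceT => z /set_mem; exact: cg.
by exists c; [exact: set_mem|move=> z /mem_set; exact: hc].
Qed.

(** A failure of the maximum principle survives the addition of [delta |z|^2] for a
    small [delta]; the maximum is then attained inside, at a point where
    [F] does not vanish. *)
Lemma max_principle_jet0 F (r b : R) : 0 <= b ->
  (forall z, normc z <= r -> {for z, continuous F}) ->
  (forall z, normc z < r -> jet 2 F z \/ F z = 0) ->
  (forall z, normc z = r -> normc (F z) <= b) ->
  forall z, normc z <= r -> normc (F z) <= b.
Proof.
move=> b0 cF jF hF z0 hz0; rewrite leNgt; apply/negP => hb.
have r0 : 0 <= r by apply: le_trans hz0; exact: normc_ge0.
set x := normc (F z0) in hb.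
have gap : 0 < x ^+ 2 - b ^+ 2 by rewrite subr_gt0 ltrXn2r // nnegrE ltW // (le_lt_trans b0).
(* Small enough for the perturbed function to exceed its values on the circle. *)
set delta := (x ^+ 2 - b ^+ 2) / (2 * (r ^+ 2 + 1)).
have r2 : 0 <= r ^+ 2 by rewrite sqr_ge0.
have d0 : 0 < delta by rewrite divr_gt0 // mulr_gt0 //; lra.
have dr : delta * r ^+ 2 < x ^+ 2 - b ^+ 2.
  rewrite /delta mulrAC ltr_pdivrMr; last by rewrite mulr_gt0 //; lra.
  by rewrite ltr_pM2l //; lra.
have [||z1 hz1 hmax] := max_on_compact (g := fun z => normc (F z) ^+ 2 + delta * normc z ^+ 2) (@closed_disk_compact r).
- by exists z0.
- move=> z hz; have c1 := continuous_normc_comp (cF z hz); have c2 := @normc_continuous z.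
  apply: continuousD; first by apply: continuousM.
  by apply: continuousM; [exact: cst_continuous|apply: continuousM].
have h0 := hmax _ hz0; rewrite /= -/x in h0.
have := normc_ge0 z1 => n1.
have n2 : normc z1 ^+ 2 <= r ^+ 2 by rewrite lerXn2r // nnegrE.
have n3 := sqr_ge0 (normc z0).
have n4 : delta * normc z1 ^+ 2 <= delta * r ^+ 2 by rewrite ler_pM2l.
have n5 : 0 <= delta * normc z0 ^+ 2 by rewrite mulr_ge0 // ltW.
have hF1 : b ^+ 2 < normc (F z1) ^+ 2 by lra.
have z1r : normc z1 < r.
  rewrite lt_neqAle hz1 andbT; apply/eqP => e; have := hF _ e.
  rewrite leNgt => /negP; apply; move: hF1; by rewrite ltr_pXn2r ?nnegrE ?normc_ge0.
case: (jF _ z1r) => [j2|F0]; last first.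
  by move: hF1; rewrite F0 normc0 expr0n /= ltNge sqr_ge0.
apply: (jet2_no_max d0 j2); apply/near_normcP; exists (r - normc z1).
  by rewrite subr_gt0.
move=> z hz; apply: hmax; rewrite /closed_disk /= -(subrK z1 z).
by apply: le_trans (le_normcD _ _) _; lra.
Qed.

Lemma bernoulli_le (y : R) n : 1 <= y -> 1 + n%:R * (y - 1) <= y ^+ n.
Proof.
move=> y1; elim: n => [|n IH]; first by rewrite mul0r addr0.
rewrite exprS; have h : 1 <= y ^+ n by rewrite exprn_ege1.
by rewrite -natr1; nra.
Qed.

Lemma exp_dominates (b x a Q : R) : 0 <= b -> b < x -> 0 < a ->
  exists n, b ^+ n * Q < x ^+ n * a.
Proof.
move=> b0 bx a0; have x0 : 0 < x by apply: le_lt_trans bx.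
have [->|bn] := eqVneq b 0; first by exists 1%N; rewrite expr1 mul0r mulr_gt0.
have {bn} b0 : 0 < b by rewrite lt_neqAle eq_sym bn.
have y1 : 1 < x / b by rewrite ltr_pdivlMr // mul1r.
set s := x / b - 1; have s0 : 0 < s by rewrite subr_gt0.
exists (Num.truncn `|Q / a / s|).+1; set n := _.+1.
have hn : Q / a / s < n%:R by apply: le_lt_trans (ler_norm _) _; exact: truncnS_gt.
have := bernoulli_le n (ltW y1); rewrite -/s => h.
have : Q / a < (x / b) ^+ n.
  by apply: lt_le_trans h; rewrite ltr_pdivrMr // in hn; lra.
rewrite ltr_pdivrMr // expr_div_n mulrAC ltr_pdivlMr ?exprn_gt0 //.
by rewrite mulrC.
Qed.

(** [f ^+ n * q] satisfies the maximum principle: at the bad points it vanishes.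
    So [|f z| ^+ n |q z|] is at most [b ^+ n] times a constant, for all [n], which
    forces [|f z| <= b] if [q.[z] != 0]; the other points are limits of these. *)
Theorem max_principle f (q : {poly R[i]}) (r b : R) : q != 0 -> 0 <= b ->
  (forall z, normc z <= r -> {for z, continuous f}) ->
  (forall z, normc z < r -> q.[z] != 0 -> jet 2 f z) ->
  (forall z, normc z = r -> normc (f z) <= b) ->
  forall z, normc z <= r -> normc (f z) <= b.
Proof.
move=> q0 b0 cf jf hf.
have H z : normc z <= r -> q.[z] != 0 -> normc (f z) <= b.
  move=> hz qz; have r0 : 0 <= r by apply: le_trans hz; exact: normc_ge0.
  rewrite leNgt; apply/negP => hb.
  have qz0 : 0 < normc q.[z].
    by rewrite lt_neqAle normc_ge0 andbT eq_sym; apply: contra qz => /eqP/eq0_normc->.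
  have [n] := exp_dominates (wnorm r q) b0 hb qz0; rewrite ltNge => /negP; apply.
  rewrite -normcX -normcM.
  apply: (@max_principle_jet0 (fun w => f w ^+ n * q.[w]) r); last exact: hz.
  - by rewrite mulr_ge0 ?exprn_ge0 // wnorm_ge0.
  - move=> w hw; apply: (@jetM _ 0 (fun w => f w ^+ n) (fun w => q.[w] : C)).
      by apply: (@jetX _ 0); exact: cf.
    exact: jet_horner.
  - move=> w hw; have [e|qw] := eqVneq q.[w] 0; [right; by rewrite e mulr0|left].
    apply: (@jetM _ 2 (fun w => f w ^+ n) (fun w => q.[w] : C)); last exact: jet_horner.
    by apply: jetX; exact: jf.
  - move=> w hw; rewrite normcM normcX ler_pM ?exprn_ge0 ?normc_ge0 //.
      by rewrite lerXn2r ?nnegrE ?normc_ge0 // hf.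
    by rewrite -hw; exact: horner_le_wnorm.
move=> z hz; rewrite leNgt; apply/negP => hb.
have zr : normc z < r.
  by rewrite lt_neqAle hz andbT; apply/eqP => /hf; rewrite leNgt hb.
have /continuous_normcP /(_ (normc (f z) - b)) := cf z hz.
rewrite subr_gt0 => /(_ hb) /near_normcP[d d0 hd].
(* Points [pt j] that tend to [z], more of them than [q] has roots. *)
set t := Num.min d (r - normc z); have t0 : 0 < t by rewrite lt_min d0 subr_gt0.
have td : t <= d by rewrite ge_min lexx.
have tr : t <= r - normc z by rewrite ge_min lexx orbT.
pose pt j : C := z + (t / j.+2%:R)%:C.
have npt j : normc (pt j - z) < t.
  rewrite /pt addrAC subrr add0r normc_real; last by rewrite divr_ge0 // ltW.
  by rewrite ltr_pdivrMr ?ltr0n // -{1}(mulr1 t) ltr_pM2l // ltr1n.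
have qpt j : q.[pt j] = 0.
  apply/eqP; case: eqVneq => // qj; have h1 := npt j.
  have h2 : normc (pt j) <= r.
    by rewrite -(subrK z (pt j)); apply: le_trans (le_normcD _ _) _; lra.
  have := H _ h2 qj; have := hd _ (lt_le_trans h1 td).
  have := normcB_le (f (pt j)) (f z); rewrite ler_norml => /andP[h3 _] h4 h5; lra.
have := @max_poly_roots _ q [seq pt j | j <- iota 0 (size q)] q0.
rewrite size_map size_iota ltnn => h; suff : false by []; apply: h.
  by apply/allP => w /mapP[j _ ->]; apply/eqP.
rewrite map_inj_uniq ?iota_uniq // => i j /addrI/(congr1 (@complex.Re R)) /=.
move=> /(mulfI (lt0r_neq0 t0)) /invr_inj /eqP; rewrite eqr_nat => /eqP[].
by [].
Qed.

End MaximumPrinciple.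

(** * Roots vary boundedly on a circle *)

Section CircleOscillation.
Variable R : realType.
Local Notation C := (R[i]^o).

(** If the monomials of exponents [i] and [j] are comparable both at [t] and at
    [t'], then [t] and [t'] are comparable: both are close to the slope
    [(P i / P j) ^ (1 / (j - i))] of the Newton polygon. *)
Lemma window_ratio (P : nat -> R) (Q t t' : R) (i j : nat) :
  1 <= Q -> 0 < t -> t <= t' -> (i < j)%N -> 0 < P i -> 0 < P j ->
  (P i * t ^+ i <= Q * (P j * t ^+ j)) -> (P j * t' ^+ j <= Q * (P i * t' ^+ i)) ->
  t' <= Q ^+ 2 * t.
Proof.
move=> Q1 t0 tt' ij Pi Pj h1 h4; have t'0 := lt_le_trans t0 tt'.
have Q0 : 0 < Q by apply: lt_le_trans Q1.
set d := (j - i)%N; have ej : j = (d + i)%N by rewrite subnK // ltnW.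
have d0 : (0 < d)%N by rewrite subn_gt0.
have {}h1 : P i <= Q * (P j * t ^+ d).
  rewrite -(ler_pM2r (exprn_gt0 i t0)); apply: le_trans h1 _.
  by rewrite {2}ej exprD !mulrA.
have {}h4 : P j * t' ^+ d <= Q * P i.
  rewrite -(ler_pM2r (exprn_gt0 i t'0)) -!mulrA -exprD -ej.
  by apply: le_trans h4 _; rewrite mulrA.
have h : t' ^+ d <= Q ^+ 2 * t ^+ d.
  rewrite -(ler_pM2l Pj); apply: le_trans h4 _.
  rewrite expr2 -mulrA mulrCA ler_pM2l //; apply: le_trans h1 _.
  by rewrite mulrCA.
have : t' ^+ d <= (Q ^+ 2 * t) ^+ d.
  apply: le_trans h _; rewrite exprMn ler_pM2r ?exprn_gt0 //.
  by rewrite ler_eXnr // exprn_ege1.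
by rewrite ler_pXn2r // nnegrE ?mulr_ge0 ?exprn_ge0 // ltW.
Qed.

(** The largest monomial at the root [w] has to be balanced by another one.  The
    pair of exponents names the edge of the Newton polygon that [w] belongs to. *)
Lemma newton_window (S : {poly {poly R[i]}}) k (c C0 Q : R) (z w : R[i]) :
  S != 0 -> (size S <= k.+1)%N -> 0 < c -> 0 <= C0 -> 1 <= Q -> k.+1%:R * C0 <= c * Q ->
  (forall j, c * wnorm 1 S`_j <= normc (S`_j).[z] <= C0 * wnorm 1 S`_j) ->
  eval2 S z w = 0 -> 0 < normc w ->
  exists p : 'I_k.+1 * 'I_k.+1, let X j := wnorm 1 S`_j * normc w ^+ j in
    [/\ p.1 != p.2, 0 < wnorm 1 S`_p.1, 0 < wnorm 1 S`_p.2,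
        X p.1 <= Q * X p.2 & X p.2 <= Q * X p.1].
Proof.
move=> S0 sS c0 C00 Q1 hQ hS Sw w0; set t := normc w in w0 *.
pose X (j : nat) := wnorm 1 S`_j * t ^+ j.
have X0 j : 0 <= X j by rewrite mulr_ge0 ?wnorm_ge0 ?ler01 // exprn_ge0 // ltW.
have [j _ hj] : exists2 j : 'I_k.+1, true & forall i : 'I_k.+1, X i <= X j.
  by have [j _ hj] := @arg_maxP _ R 'I_k.+1 ord0 xpredT (fun j => X j) isT; exists j => // i; apply: hj.
have Xj0 : 0 < X j.
  rewrite lt_neqAle X0 andbT eq_sym; apply: contra S0 => /eqP e.
  apply/eqP/polyP => i; rewrite coef0; have [hi|hi] := ltnP i (size S); last by rewrite nth_default.
  have hi' : (i < k.+1)%N by apply: leq_trans sS.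
  apply: wnorm_eq0; apply/eqP; rewrite eq_le wnorm_ge0 ?ler01 // andbT.
  have := hj (Ordinal hi'); rewrite e /X /= => h.
  by rewrite -(ler_pM2r (exprn_gt0 i w0)) mul0r.
have sumS : \sum_(i < k.+1) (S`_i).[z] * w ^+ i = 0 by rewrite -(eval2_wide z w sS).
(* The other monomials cancel the largest one. *)
have key : c * X j <= C0 * \sum_(i < k.+1 | i != j) X i.
  have e : (S`_j).[z] * w ^+ j = - \sum_(i < k.+1 | i != j) (S`_i).[z] * w ^+ i.
    by apply/eqP; rewrite -addr_eq0; move/eqP: sumS; rewrite (bigD1 j).
  apply: (@le_trans _ _ (normc ((S`_j).[z] * w ^+ j))).
    rewrite normcM normcX mulrA ler_wpM2r ?exprn_ge0 ?(ltW w0) //.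
    by have /andP[] := hS j.
  rewrite e normcN; apply: le_trans (_ : \sum_(i < k.+1 | i != j) normc ((S`_i).[z] * w ^+ i) <= _).
    by rewrite -big_filter -[leRHS]big_filter; exact: normc_sum.
  rewrite mulr_sumr; apply: ler_sum => i _; rewrite normcM normcX mulrA.
  rewrite ler_wpM2r ?exprn_ge0 ?(ltW w0) //.
  by have /andP[] := hS i.
have [[i /andP[ij hi]]|hn] := pselect (exists i : 'I_k.+1, (i != j) && (X j <= Q * X i)).
  have Xi0 : 0 < X i.
    by rewrite lt_neqAle X0 andbT eq_sym; apply: contraTneq hi => ->; rewrite mulr0 -ltNge.
  have tp n : 0 < t ^+ n by rewrite exprn_gt0.
  exists (i, j) => /=; split => //.
  - by move: Xi0; rewrite /X pmulr_lgt0.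
  - by move: Xj0; rewrite /X pmulr_lgt0.
  by apply: le_trans (hj i) _; rewrite ler_peMl.
exfalso; have h : Q * \sum_(i < k.+1 | i != j) X i < k.+1%:R * X j.
  rewrite [k.+1%:R * _](_ : _ = \sum_(i < k.+1) X j); last by rewrite sumr_const card_ord mulr_natl.
  rewrite [ltRHS](bigD1 j) //= -[ltLHS]add0r; apply: ltr_leD => //.
  rewrite mulr_sumr; apply: ler_sum => i ij; rewrite leNgt; apply/negP => hh.
  by apply: hn; exists i; rewrite ij ltW.
have Q0 : 0 < Q by apply: lt_le_trans Q1.
have keyQ : Q * (c * X j) <= Q * (C0 * \sum_(i < k.+1 | i != j) X i) by rewrite ler_pM2l.
have [C0z|C0p] := eqVneq C0 0.
  have : 0 < Q * (c * X j) by rewrite mulr_gt0 // mulr_gt0.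
  by rewrite ltNge; move: keyQ; rewrite C0z mul0r mulr0 => ->.
have {C0p}C0p : 0 < C0 by rewrite lt_neqAle eq_sym C0p.
have h2 : C0 * (Q * \sum_(i < k.+1 | i != j) X i) < C0 * (k.+1%:R * X j) by rewrite ltr_pM2l.
have h3 : k.+1%:R * C0 * X j <= c * Q * X j by rewrite ler_pM2r.
lra.
Qed.

(** A continuous [g] that varied by more than the given factor would take more
    values, in geometric progression, than there are pairs of exponents; two of
    them would share a pair, against [window_ratio].  These
    values are positive even when [g x] is zero. *)
Lemma interval_oscillation (S : {poly {poly R[i]}}) k (Q : R) (g : R -> R) (a b : R) :
  1 <= Q -> {within `[a, b], continuous g} ->
  (forall x, x \in `[a, b] -> 0 < g x ->
  exists p : 'I_k.+1 * 'I_k.+1, let X j := wnorm 1 S`_j * (g x) ^+ j in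
    [/\ p.1 != p.2, 0 < wnorm 1 S`_p.1, 0 < wnorm 1 S`_p.2,
        X p.1 <= Q * X p.2 & X p.2 <= Q * X p.1]) ->
  (forall x, x \in `[a, b] -> 0 <= g x) ->
  forall x y, x \in `[a, b] -> y \in `[a, b] ->
  g y <= (Q ^+ 2 + 1) ^+ #|{: 'I_k.+1 * 'I_k.+1}| * g x.
Proof.
move=> Q1 cg hg g0 x y xab yab; set B := Q ^+ 2 + 1; set N := #|_|.
have B1 : 1 < B by rewrite /B ltrDr exprn_gt0 // (lt_le_trans _ Q1).
have B0 : 0 < B by apply: lt_trans B1.
rewrite leNgt; apply/negP => hlt.
have attain v : g x <= v <= g y -> exists2 s, s \in `[a, b] & g s = v.
  move=> /andP[v1 v2].
  have inab l r s : l \in `[a, b] -> r \in `[a, b] -> s \in `[l, r] -> s \in `[a, b].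
    rewrite !in_itv /= => /andP[l1 l2] /andP[r1 r2] /andP[s1 s2].
    by rewrite (le_trans l1 s1) (le_trans s2 r2).
  have sub l r : l \in `[a, b] -> r \in `[a, b] -> {within `[l, r], continuous g}.
    by move=> la rb; apply: continuous_subspaceW cg => s; exact: inab.
  have [xy|/ltW xy] := leP x y.
    have [|s hs <-] := IVT xy (sub _ _ xab yab) (v := v).
      by rewrite ge_min le_max v1 v2 orbT.
    by exists s => //; exact: inab hs.
  have [|s hs <-] := IVT xy (sub _ _ yab xab) (v := v).
    by rewrite ge_min le_max v1 v2 orbT.
  by exists s => //; exact: inab hs.
have gx0 := g0 _ xab.
have gy0 : 0 < g y by apply: le_lt_trans hlt; rewrite mulr_ge0 // exprn_ge0 // ltW.
(* The levels [g y / B ^+ l] lie between [g x] and [g y]. *)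
have val (l : 'I_N.+1) : exists p : 'I_k.+1 * 'I_k.+1,
    let X j := wnorm 1 S`_j * (g y / B ^+ l) ^+ j in
    [/\ p.1 != p.2, 0 < wnorm 1 S`_p.1, 0 < wnorm 1 S`_p.2,
        X p.1 <= Q * X p.2 & X p.2 <= Q * X p.1].
  have [|s hs es] := attain (g y / B ^+ l).
    apply/andP; split; last by rewrite ler_pdivrMr ?exprn_gt0 // ler_peMr ?exprn_ege1 // ltW.
    rewrite ler_pdivlMr ?exprn_gt0 // mulrC ltW //; apply: le_lt_trans hlt.
    by rewrite ler_wpM2r // ler_weXn2l ?(ltW B1) // -ltnS.
  by have := hg s hs; rewrite es; apply; rewrite divr_gt0 // exprn_gt0.
have [pr hpr] := fin_all_exists val.
have : ~~ injectiveb pr.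
  apply/negP => /injectiveP /leq_card; rewrite card_ord => h.
  by have := leq_trans h (leqnn _); rewrite ltnn.
case/injectivePn => l [l' ll' e].
wlog lt : l l' ll' e / (l < l')%N.
  move=> H; have := ll'; rewrite -val_eqE neq_ltn => /orP[h|h]; first exact: (H l l').
  by apply: (H l' l) => //; rewrite eq_sym.
have [ne P1 P2 h1 h2] := hpr l; have [_ _ _ h3 h4] := hpr l'; rewrite -e in h3 h4.
set tl := g y / B ^+ l in h1 h2; set tl' := g y / B ^+ l' in h3 h4.
have tl'0 : 0 < tl' by rewrite divr_gt0 // exprn_gt0.
have hB : B * tl' <= tl.
  have hh : B * B ^+ l <= B ^+ l' by rewrite -exprS ler_weXn2l // ltW.
  rewrite /tl /tl' ler_pdivlMr ?exprn_gt0 //.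
  have -> : B * (g y / B ^+ l') * B ^+ l = g y * ((B * B ^+ l) / B ^+ l') by ring.
  by rewrite ler_piMr ?(ltW gy0) // ler_pdivrMr ?exprn_gt0 // mul1r.
have le : tl' <= tl by apply: le_trans hB; rewrite ler_peMl ?ltW.
have : tl <= Q ^+ 2 * tl'.
  have := ne; rewrite -val_eqE neq_ltn => /orP[h|h].
    exact: (@window_ratio (fun j => wnorm 1 S`_j) Q tl' tl _ _ Q1 tl'0 le h).
  exact: (@window_ratio (fun j => wnorm 1 S`_j) Q tl' tl _ _ Q1 tl'0 le h).
by rewrite /B in hB; lra.
Qed.

(** The upper ([s = 1]) and the lower ([s = -1]) half of the circle of radius [r],
    as graphs over the real axis. *)
Definition arc (r s x : R) : C := x%:C + 'i%C * (s * Num.sqrt (r ^+ 2 - x ^+ 2))%:C.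

Lemma arc_continuous r s : continuous (arc r s : R -> C).
Proof.
move=> x; apply: (@continuousD _ _ _ (fun x : R => x%:C : C)
   (fun x : R => 'i%C * (s * Num.sqrt (r ^+ 2 - x ^+ 2))%:C : C)).
  exact: real_complex_continuous.
apply: (@continuousM _ _ (fun=> 'i%C)
   (fun x : R => (s * Num.sqrt (r ^+ 2 - x ^+ 2))%:C : C)); first exact: cst_continuous.
apply: (@continuous_comp _ _ _ (fun x : R => s * Num.sqrt (r ^+ 2 - x ^+ 2)));
  last exact: real_complex_continuous.
apply: continuousM; first exact: cst_continuous.
apply: (@continuous_comp _ _ _ (fun x : R => r ^+ 2 - x ^+ 2)); last exact: sqrt_continuous.
by apply: continuousB; [exact: cst_continuous|exact: exprn_continuous].
Qed.

Lemma arcE (r : R) (z : C) : normc z = r ->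
  z = arc r (if 0 <= complex.Im z then 1 else -1) (complex.Re z).
Proof.
move=> <-; rewrite /arc normc_sqr [complex.Re z ^+ 2 + _]addrC addrK sqrtr_sqr.
case: z => a b /=.
apply/eqP; rewrite eq_complex /=; apply/andP; split; apply/eqP; first ring.
case: (leP 0 b) => hb; first by rewrite ger0_norm //; ring.
by rewrite ltr0_norm //; ring.
Qed.

Lemma normc_arc (r s x : R) : s ^+ 2 = 1 -> 0 <= r -> x \in `[- r, r] -> normc (arc r s x) = r.
Proof.
move=> s1 r0; rewrite in_itv /= => /andP[x1 x2].
have h : 0 <= r ^+ 2 - x ^+ 2 by nra.
suff /eqP : normc (arc r s x) ^+ 2 = r ^+ 2 by rewrite eqrXn2 ?normc_ge0 // => /eqP.
rewrite normc_sqr.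
rewrite [complex.Re _](_ : _ = x); last by rewrite /= ; ring.
rewrite [complex.Im _](_ : _ = s * Num.sqrt (r ^+ 2 - x ^+ 2)); last by rewrite /= ; ring.
by rewrite exprMn s1 sqr_sqrtr //; ring.
Qed.

(** Both halves of the circle end at the point [r], so two applications of
    [interval_oscillation] relate any two points. *)
Lemma circle_oscillation k (c C0 : R) : 0 < c -> 0 <= C0 ->
  exists2 B : R, 1 <= B & forall (S : {poly {poly R[i]}}) (r : R) (u : C -> C),
  S != 0 -> (size S <= k.+1)%N -> 0 <= r ->
  (forall j z, normc z = r -> c * wnorm 1 S`_j <= normc (S`_j).[z] <= C0 * wnorm 1 S`_j) ->
  (forall z, normc z = r -> {for z, continuous u} /\ eval2 S z (u z) = 0) ->
  forall z z', normc z = r -> normc z' = r -> normc (u z') <= B * normc (u z).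
Proof.
move=> c0 C00; set Q := 1 + k.+1%:R * C0 / c.
have Q1 : 1 <= Q by rewrite lerDl divr_ge0 ?mulr_ge0 // ltW.
have hQ : k.+1%:R * C0 <= c * Q.
  rewrite /Q mulrDr mulr1 mulrC (mulrC c) divfK ?lt0r_neq0 //; lra.
set B := (Q ^+ 2 + 1) ^+ #|{: 'I_k.+1 * 'I_k.+1}|.
have Q20 : 1 <= Q ^+ 2 by rewrite exprn_ege1.
have B1 : 1 <= B by rewrite /B exprn_ege1 //; lra.
exists (B * B) => [|S r u S0 sS r0 hS hu z z' hz hz']; first by nra.
have H (s : R) : s ^+ 2 = 1 -> forall x y, x \in `[- r, r] -> y \in `[- r, r] ->
    normc (u (arc r s y)) <= B * normc (u (arc r s x)).
  move=> s1; apply: (@interval_oscillation S k Q (fun x => normc (u (arc r s x))) (- r) r) => //.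
  - apply: continuous_in_subspaceT => x /set_mem xr.
    have cu := continuous_normc_comp (hu _ (normc_arc s1 r0 xr)).1.
    by move=> P hP; exact: (arc_continuous (cu P hP)).
  - move=> x xr gx; have nx := normc_arc s1 r0 xr.
    apply: (@newton_window S k c C0 Q (arc r s x)) => //; last exact: (hu _ nx).2.
    by move=> j; exact: hS.
  by move=> x _; exact: normc_ge0.
have rr : r \in `[- r, r] by rewrite in_itv /= lexx andbT; lra.
have arcr s : arc r s r = r%:C :> C by rewrite /arc subrr sqrtr0 mulr0 mulr0 addr0.
have inr w : normc w = r -> complex.Re w \in `[- r, r].
  move=> hw; have := normc_sqr w; rewrite hw => e.
  have := sqr_ge0 (complex.Im w) => h; rewrite in_itv /=; apply/andP; split; nra.
have sg (b : bool) : (if b then 1 else -1 : R) ^+ 2 = 1 by case: b; ring.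
have h1 := H _ (sg (0 <= complex.Im z)) _ _ (inr _ hz) rr.
have h2 := H _ (sg (0 <= complex.Im z')) _ _ rr (inr _ hz').
rewrite -(arcE hz) arcr in h1; rewrite -(arcE hz') arcr in h2.
apply: le_trans h2 _; rewrite -mulrA ler_wpM2l //; lra.
Qed.

End CircleOscillation.

(** * Functions whose graph lies on an algebraic curve *)

Section AlgebraicFunctions.
Variable R : realType.
Local Notation C := (R[i]^o).

Lemma near_disk (rho : R) (z : C) : normc z < rho -> \forall w \near z, normc w < rho.
Proof.
move=> hz; apply/near_normcP; exists (rho - normc z); first by rewrite subr_gt0.
move=> w hw; rewrite -(subrK z w); apply: le_lt_trans (le_normcD _ _) _; lra.
Qed.

Definition algebraic_on (rho : R) (S : {poly {poly R[i]}}) (f : C -> C) :=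
  forall z : C, normc z < rho -> {for z, continuous f} /\ eval2 S z (f z) = 0.

(** The exceptional polynomial [q] depends on [S] only, so it serves two functions
    with the same equation, and then their difference, at once. *)
Lemma algebraic_jet (S : {poly {poly R[i]}}) : S != 0 ->
  exists2 q : {poly R[i]}, q != 0 & forall rho f, algebraic_on rho S f ->
  forall n (z : C), normc z < rho -> q.[z] != 0 -> jet n f z.
Proof.
move=> S0; have [T [q [q0 hq]]] := generic_simple_root S0; exists q => // rho f af n z hz qz.
have [cf Sf] := af z hz.
apply: (@jet_implicit _ _ T) => //; last exact: (hq _ _ qz Sf).2.
have qn : \forall w \near z, q.[w] != 0.
  by apply: (@near_neq0 _ (fun w => q.[w] : C)); [exact: (@jet_horner _ 0)|exact: qz].
apply: filterS2 qn (near_disk hz) => w qw hw.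
exact: (hq _ _ qw (af w hw).2).1.
Qed.

Lemma algebraic_max (S : {poly {poly R[i]}}) rho r b f : S != 0 -> r < rho -> 0 <= b ->
  algebraic_on rho S f -> (forall z : C, normc z = r -> normc (f z) <= b) ->
  forall z : C, normc z <= r -> normc (f z) <= b.
Proof.
move=> S0 rr b0 af hb; have [q q0 hq] := algebraic_jet S0.
apply: (max_principle q0) => // z hz.
  by have [] := af z (le_lt_trans hz rr).
by apply: hq af _ _ _; apply: lt_trans rr.
Qed.

(** The maximum principle for [1 / (f - g)]. *)
Lemma algebraic_min_sub (S : {poly {poly R[i]}}) rho r b f g : S != 0 -> r < rho -> 0 < b ->
  algebraic_on rho S f -> algebraic_on rho S g ->
  (forall z : C, normc z < rho -> f z != g z) ->
  (forall z : C, normc z = r -> b <= normc (f z - g z)) ->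
  forall z : C, normc z <= r -> b <= normc (f z - g z).
Proof.
move=> S0 rr b0 af ag fg hb; have [q q0 hq] := algebraic_jet S0.
have fg0 (z : C) : normc z < rho -> f z - g z != 0 by move=> /fg; rewrite subr_eq0.
have fgp (z : C) : normc z < rho -> 0 < normc (f z - g z).
  by move=> /fg0 h; rewrite lt_neqAle normc_ge0 andbT eq_sym; apply: contra h => /eqP/eq0_normc->.
have jinv n (z : C) : normc z < rho -> jet n f z -> jet n g z -> jet n (fun z => (f z - g z)^-1) z.
  move=> hz jf jg; apply: (@jetV _ _ (fun z => f z - g z)); last exact: fg0.
  by apply: jetD => //; exact: jetN.
have inv_le (z : C) : normc z < rho -> normc (f z - g z)^-1 <= b^-1 -> b <= normc (f z - g z).
  by move=> hz; rewrite normcV lef_pV2 // posrE fgp.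
move=> z hz; apply: inv_le; first exact: le_lt_trans rr.
move: z hz; apply: (max_principle q0) => //.
- by rewrite invr_ge0 ltW.
- move=> z hz; have hz' := le_lt_trans hz rr.
  exact: (jinv 0%N z hz' (af z hz').1 (ag z hz').1).
- move=> z hz qz; have hz' := lt_trans hz rr.
  by apply: jinv => //; [exact: hq af _ _ hz' qz|exact: hq ag _ _ hz' qz].
move=> z hz; have hz' : normc z < rho by rewrite hz.
by rewrite normcV lef_pV2 ?posrE ?fgp // hb.
Qed.

(** Connectedness of the disk, in the form of an induction principle: a property
    that is open and closed in the disk holds everywhere in it. *)
Lemma disk_connected (rho : R) (A : set C) (z0 : C) :
  normc z0 < rho -> A z0 ->
  (forall z : C, normc z < rho -> A z -> \forall w \near z, normc w < rho -> A w) ->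
  (forall z : C, normc z < rho -> ~ A z -> \forall w \near z, normc w < rho -> ~ A w) ->
  forall z : C, normc z < rho -> A z.
Proof.
move=> h0 A0 Aopen Aclosed z1 h1.
pose g (t : R) : C := z0 + t%:C * (z1 - z0).
have cg : continuous (g : R -> C).
  move=> t; apply: (@continuousD _ _ _ (fun=> z0) (fun t : R => t%:C * (z1 - z0) : C)).
    exact: cst_continuous.
  apply: (@continuousM _ _ (fun t : R => t%:C : C) (fun=> z1 - z0)); last exact: cst_continuous.
  exact: real_complex_continuous.
have gd t : t \in `[0, 1] -> normc (g t) < rho.
  rewrite in_itv /= => /andP[t0 t1].
  have -> : g t = (1 - t)%:C * z0 + t%:C * z1 by rewrite /g rmorphB rmorph1; ring.
  apply: le_lt_trans (le_normcD _ _) _; rewrite !normcM !normc_real ?subr_ge0 //.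
  have [->|tn] := eqVneq t 0; first by rewrite subr0 mul0r addr0 mul1r.
  have tp : 0 < t by rewrite lt_neqAle eq_sym tn.
  have a1 : (1 - t) * normc z0 <= (1 - t) * rho by rewrite ler_wpM2l ?subr_ge0 // ltW.
  have a2 : t * normc z1 < t * rho by rewrite ltr_pM2l.
  lra.
pose I := `[0%R, 1%R]%classic : set R; pose B := [set t | I t /\ A (g t)].
have BI : B = I.
  apply: (@segment_connected R 0 1).
  - exists 0; split; first by rewrite /I /= in_itv /= lexx ler01.
    by rewrite /g mul0r addr0.
  - exists (interior [set t | I t -> A (g t)]); first exact: open_interior.
    apply/seteqP; split => t; last by move=> [It /interior_subset h]; split=> //; exact: h.
    move=> [It At]; split=> //.
    have hn : \forall s \near t, normc (g s) < rho -> A (g s) := cg t _ (Aopen _ (gd t It) At).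
    by apply: filterS hn => s /= hs Is; apply: hs; exact: gd.
  - exists (closure B); first exact: closed_closure.
    apply/seteqP; split => t; first by move=> Bt; split; [exact: Bt.1|exact: subset_closure].
    move=> [It clt]; split=> //; apply: contrapT => nA.
    have hn := cg t _ (Aclosed _ (gd t It) nA).
    have [s [[Is As] hs]] := clt _ hn.
    by apply: hs => //; exact: gd.
have : I 1 by rewrite /I /= in_itv /= lexx ler01.
rewrite -BI => -[_]; rewrite /g mul1r.
by rewrite addrC subrK.
Qed.

Definition fiber_poly (k : nat) (T : {poly {poly R[i]}}) (z : R[i]) : {poly R[i]} :=
  \poly_(j < k.+1) (T`_j).[z].

Lemma horner_fiber_poly (T : {poly {poly R[i]}}) k z w : (size T <= k.+1)%N ->
  (fiber_poly k T z).[w] = eval2 T z w.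
Proof.
move=> sT; rewrite (eval2_wide _ _ sT) (@horner_coef_wide _ k.+1) ?size_poly //.
by apply: eq_bigr => j _; rewrite coef_poly ltn_ord.
Qed.

(** Let [p_j] be the coefficient of [w ^+ j] in [T], [P_j = wnorm 1 p_j], and [s] the
    sum of the [P_j t ^+ j] for [j > 0].  Since [|f| <= m < t / C1] and
    [T(x, f x) = 0] at the nodes [x], the values [p_0(x)] are [O(s / C1)], and so is
    [P_0] by interpolation.  If all the roots of [T(z, .)] had modulus at least
    [eta t], [wnorm_le_coef0] would bound [s] by a constant times [P_0], which is
    impossible when [C1] is large. *)
Lemma exists_small_root (T : {poly {poly R[i]}}) k (xs : seq R[i]) (f : R[i] -> R[i])
    (z : R[i]) (c C0 L eta C1 m t : R) :
  T != 0 -> (size T <= k.+1)%N -> (forall j, (size (T`_j)%R <= k.+1)%N) ->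
  size xs = k.+1 ->
  (forall (p : {poly R[i]}) (s : R), (size p <= size xs)%N -> (forall x, x \in xs -> normc p.[x] <= s) ->
    wnorm 1 p <= L * s) ->
  (forall x, x \in xs -> eval2 T x (f x) = 0 /\ normc (f x) <= m) ->
  (forall j x, x \in xs -> normc (T`_j).[x] <= C0 * wnorm 1 T`_j) ->
  (forall j, c * wnorm 1 T`_j <= normc (T`_j).[z] <= C0 * wnorm 1 T`_j) ->
  0 < c -> 0 <= C0 -> 0 <= L -> 0 < eta -> eta <= 1 -> 1 <= C1 -> 0 <= m -> C1 * m < t ->
  eta ^- k * 2 ^+ k * C0 ^+ 2 * L < c * C1 ->
  exists2 w, eval2 T z w = 0 & normc w < eta * t.
Proof.
move=> T0 sT sTj sxs hL hf hxs hz c0 C00 L0 e0 e1 C11 m0 C1m hC1.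
have C1p : 0 < C1 by apply: lt_le_trans C11.
have t0 : 0 < t by apply: le_lt_trans C1m; rewrite mulr_ge0 // ltW.
have mt : m <= t by apply: le_trans (ltW C1m); rewrite ler_peMl.
have P_ge0 p : 0 <= wnorm 1 p by exact: wnorm_ge0.
set s := \sum_(j < k) wnorm 1 T`_j.+1 * t ^+ j.+1.
(* Interpolation of [p_0], whose values at the nodes are minus the other terms
   of [T(x, f x)]. *)
have P0 : wnorm 1 T`_0 <= L * (C0 * s / C1).
  apply: hL => [|x xxs]; first by rewrite sxs.
  have [Tx fx] := hf x xxs; move: Tx; rewrite (eval2_wide _ _ sT) big_ord_recl expr0 mulr1.
  move/eqP; rewrite addr_eq0 => /eqP->; rewrite normcN.
  apply: le_trans (normc_sum _ _) _; rewrite /s mulr_sumr mulr_suml.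
  apply: ler_sum => j _; rewrite normcM normcX -mulrA mulrA -mulrA /= /bump add1n.
  apply: (@le_trans _ _ ((C0 * wnorm 1 T`_j.+1) * (t ^+ j.+1 / C1))); last by rewrite !mulrA.
  have fp := normc_ge0 (f x).
  have h1 : normc (f x) ^+ j.+1 <= t ^+ j.+1 / C1.
    rewrite ler_pdivlMr // !exprS mulrAC; apply: ler_pM.
    - by rewrite mulr_ge0 // ltW.
    - by rewrite exprn_ge0.
    - by rewrite mulrC; apply: le_trans (ltW C1m); rewrite ler_pM2l.
    by rewrite lerXn2r ?nnegrE ?(ltW t0) // (le_trans fx).
  by apply: ler_pM; rewrite ?normc_ge0 ?exprn_ge0 //; exact: hxs.
have s0 : 0 <= s by apply: sumr_ge0 => j _; rewrite mulr_ge0 ?P_ge0 ?exprn_ge0 ?(ltW t0) //.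
have s_gt0 : 0 < s.
  rewrite lt_neqAle s0 andbT eq_sym; apply: contra T0 => /eqP es.
  apply/eqP/polyP => i; rewrite coef0; apply: wnorm_eq0; apply/eqP.
  rewrite eq_le P_ge0 andbT; case: i => [|i].
    by apply: le_trans P0 _; rewrite es mulr0 mul0r mulr0.
  have [hi|hi] := ltnP i k; last by rewrite nth_default ?(leq_trans sT) // /wnorm size_poly0 big_ord0.
  rewrite -(ler_pM2r (exprn_gt0 i.+1 t0)) mul0r -es /s (bigD1 (Ordinal hi)) //= lerDl.
  by apply: sumr_ge0 => j _; rewrite mulr_ge0 ?P_ge0 ?exprn_ge0 ?(ltW t0) //.
set tau := eta * t; have tau0 : 0 < tau by rewrite mulr_gt0.
set q := fiber_poly k T z.
have cq j : (j < k.+1)%N -> q`_j = (T`_j).[z] by move=> hj; rewrite coef_poly hj.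
have sq : (size q <= k.+1)%N by exact: size_poly.
have [[w /andP[rw nw]]|hn] := pselect (exists w, root q w && (normc w < tau)).
  by exists w => //; rewrite -(horner_fiber_poly _ _ sT); apply/eqP.
exfalso; have := @wnorm_le_coef0 R tau q k tau0 sq.
have hb b : root q b -> tau <= normc b.
  by move=> rb; rewrite leNgt; apply/negP => h; apply: hn; exists b; rewrite rb.
move=> /(_ hb); rewrite cq // => h1.
have h2 : normc (T`_0).[z] <= C0 * (L * (C0 * s / C1)).
  have /andP[_ h] := hz 0%N; apply: le_trans h _.
  by rewrite ler_wpM2l.
have h3 : c * s <= eta ^- k * wnorm tau q.
  rewrite (wnormE _ sq) big_ord_recl mulrDr.
  apply: (@le_trans _ _ (eta ^- k * \sum_(i < k) normc q`_i.+1 * tau ^+ i.+1)); last first.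
    by rewrite lerDr !mulr_ge0 ?invr_ge0 ?exprn_ge0 ?normc_ge0 ?(ltW e0) ?(ltW tau0).
  rewrite /s !mulr_sumr; apply: ler_sum => j _; rewrite cq ?ltnS //.
  rewrite /tau exprMn mulrA [leRHS]mulrCA.
  have /andP[h _] := hz j.+1.
  apply: le_trans (_ : normc (T`_j.+1).[z] * t ^+ j.+1 <= _).
    by rewrite ler_wpM2r // exprn_ge0 // ltW.
  rewrite ler_wpM2l ?normc_ge0 // mulrA ler_peMl ?exprn_ge0 ?(ltW t0) //.
  rewrite mulrC ler_pdivlMr ?exprn_gt0 // mul1r.
  by rewrite ler_wiXn2l ?(ltW e0).
have ek : 0 < eta ^- k by rewrite invr_gt0 exprn_gt0.
have h4 : c * s <= eta ^- k * (2 ^+ k * (C0 * (L * (C0 * s / C1)))).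
  apply: le_trans h3 _; rewrite ler_pM2l //; apply: le_trans h1 _.
  by rewrite ler_pM2l // exprn_gt0.
have e5 : eta ^- k * (2 ^+ k * (C0 * (L * (C0 * s / C1)))) =
    eta ^- k * 2 ^+ k * C0 ^+ 2 * L * s / C1 by ring.
move: h4; rewrite e5 ler_pdivlMr // mulrAC ler_pM2r // => h6.
by move: hC1; rewrite ltNge h6.
Qed.

End AlgebraicFunctions.

(** * The uniform bound *)

Section UniformBound.
Variable R : realType.
Local Notation C := (R[i]^o).

Lemma near_finite_set (T : choiceType) (F : set T) (z : C) (P : T -> C -> Prop) :
  finite_set F -> (forall E, F E -> \forall w \near z, P E w) ->
  \forall w \near z, forall E, F E -> P E w.
Proof.
move=> /finite_fsetP[X ->] hP.
exact: (@filter_bigI C T X P (nbhs z) (nbhs_filter z)).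
Qed.

(** The set where [f = h] is closed in the disk.  It is open because near a common
    point the graph of [f] meets no other member of [F]: the other graphs
    are disjoint from that of [h] and finitely many, and a vertical line through
    the common point is met nowhere else. *)
Lemma graphs_agree (rho : R) (f h : C -> C) (F : set (set (C * C))) (z0 : C) :
  finite_set F -> (forall E, F E -> is_vertical_line E \/ is_holomorphic_graph rho E) ->
  trivIset (F `&` is_holomorphic_graph rho) id ->
  graph_on (disk rho) f `<=` \bigcup_(E in F) E ->
  holomorphic_on (disk rho) f -> holomorphic_on (disk rho) h ->
  F (graph_on (disk rho) h) ->
  normc z0 < rho -> f z0 = h z0 -> forall z : C, normc z < rho -> f z = h z.
Proof.
move=> finF linesgraphs disj fF holf holh Fh h0 e0.
apply: (@disk_connected _ rho [set z | f z = h z] z0) => //= z hz; last first.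
  move=> /eqP fh; have cf := holomorphic_continuous holf (proj2 (diskP rho z) hz).
  have ch := holomorphic_continuous holh (proj2 (diskP rho z) hz).
  have : \forall w \near z, f w - h w != 0.
    apply: (@near_neq0 _ (fun w => f w - h w)); last by rewrite subr_eq0.
    exact: (@jetD _ 0 f (fun w => - h w) z cf (@jetN _ 0 h z ch)).
  by apply: filterS => w; rewrite subr_eq0 => /eqP.
move=> fh; suff : \forall w \near z, forall E, F E -> E (w, f w) -> normc w < rho -> f w = h w.
  apply: filterS => w hw wr; have [|E FE Ew] := fF (w, f w); last exact: hw Ew wr.
  by split => //=; apply/diskP.
apply: near_finite_set => // E FE.
have [[zs Es]|[g [holg Eg]]] := linesgraphs E FE.
  have [ez|zn] := eqVneq zs z.
    by near=> w; rewrite Es /= ez => ->.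
  have : \forall w \near z, zs - w != 0.
    apply: (@near_neq0 _ (fun w : C => zs - w)); last by rewrite subr_eq0.
    by apply: continuousB; [exact: cst_continuous|exact: cvg_id].
  by apply: filterS => w nw; rewrite Es /= => ew; rewrite ew subrr eqxx in nw.
have [gh|gh] := eqVneq (g z) (h z).
  have EE : E = graph_on (disk rho) h.
    apply: disj.
    - by split=> //; exists g.
    - by split=> //; exists h.
    exists (z, h z); split; rewrite /= ?Eg; split => //=; by apply/diskP.
  by near=> w; rewrite EE => -[].
have cf := holomorphic_continuous holf (proj2 (diskP rho z) hz).
have cg := holomorphic_continuous holg (proj2 (diskP rho z) hz).
have : \forall w \near z, f w - g w != 0.
  apply: (@near_neq0 _ (fun w => f w - g w)); last by rewrite subr_eq0 fh eq_sym.
  exact: (@jetD _ 0 f (fun w => - g w) z cf (@jetN _ 0 g z cg)).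
by apply: filterS => w nw; rewrite Eg => -[/= _ e]; rewrite e subrr eqxx in nw.
Unshelve. all: by end_near. Qed.

Lemma algebraic_on_graph (rho : R) (T : {poly {poly R[i]}}) (f : C -> C) :
  holomorphic_on (disk rho) f ->
  (forall z : C, normc z < rho -> eval2 T z (f z) = 0) -> algebraic_on rho T f.
Proof.
move=> holf fT z hz; split; last exact: fT.
exact: holomorphic_continuous holf (proj2 (diskP rho z) hz).
Qed.

(** The nodes [xs] stand for [k + 1] points of [K].  The contradiction comes from
    comparing [|f - h|] on the circle with its value at the first node. *)
Lemma uniform_bound_V (k : nat) (rho r0 : R) (xs : seq C) :
  0 <= r0 -> r0 < rho -> uniq xs -> size xs = k.+1 -> {in xs, forall x, normc x <= r0} ->
  exists2 A : R, 0 < A & forall f : C -> C, V k rho f ->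
  forall m : R, 0 <= m -> {in xs, forall x, normc (f x) <= m} ->
  forall z : C, normc z <= r0 -> normc (f z) <= A * m.
Proof.
move=> r00 r0rho uxs sxs xsr0.
have rho0 : 0 < rho by apply: le_lt_trans r0rho.
have [L L0 hL] := interpolation_bound uxs.
have [c c0 hc] := exists_good_circle k r00 r0rho.
set C0 := (1 + rho) ^+ k; have C00 : 0 <= C0 by rewrite exprn_ge0 //; lra.
have hC0 (p : {poly R[i]}) (z : C) : (size p <= k.+1)%N -> normc z <= rho -> normc p.[z] <= C0 * wnorm 1 p.
  move=> sp hz; apply: le_trans (horner_le_wnorm _ _) _.
  have h : normc z <= 1 + rho by lra.
  apply: le_trans (wnorm_le _ (normc_ge0 z) h) _.
  by apply: wnorm_le_expr => //; lra.
have [B B1 hB] := circle_oscillation k c0 C00.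
have B0 : 0 < B by apply: lt_le_trans B1.
(* With this [eta], a root below [eta t] at one point of the circle stays below
   [t / (4 B)] on the circle, while [|f|] stays above [t / B]. *)
set eta := (4 * B ^+ 2)^-1.
have BB : 1 <= B ^+ 2 by rewrite exprn_ege1.
have eta0 : 0 < eta by rewrite invr_gt0; lra.
have eta1 : eta <= 1 by rewrite invf_le1; lra.
set D := eta ^- k * 2 ^+ k * C0 ^+ 2 * L.
have D0 : 0 <= D.
  by rewrite /D !mulr_ge0 ?invr_ge0 ?exprn_ge0 ?(ltW eta0) //; lra.
(* The term [D / c] is what [exists_small_root] asks for, and [2 B] makes [m]
   smaller than [t / (2 B)] in the final comparison. *)
set C1 := 1 + 2 * B + D / c.
have Dc : 0 <= D / c by rewrite divr_ge0 // ltW.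
have DC1 : D < c * C1.
  by rewrite /C1 mulrDr mulrCA divff ?lt0r_neq0 // mulr1 ltrDr mulr_gt0 //; lra.
have C1B : 2 * B <= C1 by rewrite /C1; lra.
have C11 : 1 <= C1 by rewrite /C1; lra.
exists (B * C1); first by rewrite mulr_gt0 //; lra.
move=> f [holf [S [S0 sS fS [F [cardF lg disj eF]]]]] m m0 hm.
have [T [T0 sT sTj eT]] := peval_eval2 S0 sS.
have fT (z : C) : normc z < rho -> eval2 T z (f z) = 0.
  by move=> hz; rewrite -eT; apply: (fS (z, f z)); split => //=; apply/diskP.
have af := algebraic_on_graph holf fT.
have [r /andP[r1 r2] hr] := hc T sT sTj.
have rp : 0 < r by apply: le_lt_trans r1.
pose zr : C := r%:C; have nzr : normc zr = r by rewrite normc_real // ltW.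
have zrd : normc zr < rho by rewrite nzr.
have hcoef j (z : C) : normc z = r -> c * wnorm 1 T`_j <= normc (T`_j).[z] <= C0 * wnorm 1 T`_j.
  by move=> hz; rewrite hr //= hC0 // hz ltW.
have osc u : algebraic_on rho T u -> forall z z' : C, normc z = r -> normc z' = r ->
    normc (u z') <= B * normc (u z).
  move=> au; apply: (hB T r u) => //; first exact: ltW.
  by move=> z hz; apply: au; rewrite hz.
set t := normc (f zr).
suff tm : t <= C1 * m.
  move=> z hz; apply: (@algebraic_max _ T rho r) => //.
  - by rewrite !mulr_ge0 //; lra.
  - move=> w hw; apply: le_trans (osc f af _ _ nzr hw) _.
    by rewrite -mulrA ler_pM2l.
  by apply: le_trans hz _; exact: ltW.
rewrite leNgt; apply/negP => C1m.
have t0 : 0 < t by apply: le_lt_trans C1m; rewrite mulr_ge0 //; lra.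
have [w Tw nw] : exists2 w, eval2 T zr w = 0 & normc w < eta * t.
  apply: (@exists_small_root _ T k xs f zr c C0 L eta C1 m t) => //.
  - move=> x xxs; split; last exact: hm.
    by apply: fT; apply: le_lt_trans r0rho; exact: xsr0.
  - by move=> j x xxs; apply: hC0 => //; apply: le_trans (ltW r0rho); exact: xsr0.
  by move=> j; apply: hcoef.
have FU : \bigcup_(E in F) E = curve S `&` (disk rho `*` setT) by rewrite eF.
have curveP (p : C * C) : curve S p -> eval2 T p.1 p.2 = 0 by rewrite /curve /= eT.
have [E FE Ew] : (\bigcup_(E in F) E) (zr, w).
  rewrite FU; split; first by rewrite /curve /= eT.
  by split => //=; apply/diskP.
have [[zs Es]|[h [holh Eh]]] := lg E FE.
  (* A vertical line through the circle would be a common zero of all the [p_j]. *)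
  have Ezs : zs = zr by move: Ew; rewrite Es.
  have all0 v : eval2 T zr v = 0.
    apply: (curveP (zr, v)); have : (\bigcup_(E in F) E) (zr, v).
      by exists E => //; rewrite Es /= Ezs.
    by rewrite FU => -[].
  move/eqP: T0; apply; apply/polyP => j; rewrite coef0; apply: wnorm_eq0; apply/eqP.
  rewrite eq_le wnorm_ge0 ?ler01 // andbT -(ler_pM2l c0) mulr0.
  apply: le_trans (andP (hcoef j zr nzr)).1 _.
  suff q0 : fiber_poly k T zr = 0.
    have [hj|hj] := ltnP j k.+1.
      have := congr1 (fun p : {poly R[i]} => p`_j) q0.
      by rewrite coef_poly hj coef0 => ->; rewrite normc0.
    by rewrite nth_default ?horner0 ?normc0 // (leq_trans sT).
  apply/eqP; case: eqVneq => // qn0.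
  have := @max_poly_roots _ _ [seq i%:R | i <- iota 0 (size (fiber_poly k T zr))] qn0.
  rewrite size_map size_iota ltnn => hh; suff : false by []; apply: hh.
    apply/allP => v _; by rewrite /root (horner_fiber_poly _ _ sT) all0.
  by rewrite map_inj_uniq ?iota_uniq // => i1 i2 /eqP; rewrite eqr_nat => /eqP.
have hS (z : C) : normc z < rho -> eval2 T z (h z) = 0.
  move=> hz; apply: (curveP (z, h z)); have : (\bigcup_(E in F) E) (z, h z).
    by exists E => //; rewrite Eh; split => //=; apply/diskP.
  by rewrite FU => -[].
have ah := algebraic_on_graph holh hS.
have hw : h zr = w by move: Ew; rewrite Eh => -[].
have fh (z : C) : normc z < rho -> f z != h z.
  move=> hz; apply/eqP => efh.
  have finF : finite_set F by exact: card_le_finite cardF (finite_II k).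
  have fF : graph_on (disk rho) f `<=` \bigcup_(E in F) E.
    by move=> p pf; rewrite FU; split; [exact: fS|split; [exact: pf.1|]].
  have := graphs_agree finF lg disj fF holf holh; rewrite -Eh => /(_ z FE hz efh zr zrd) e.
  move: nw; rewrite -hw -e -/t ltNge => /negP; apply.
  by rewrite ler_piMl // ltW.
have tB : t / (4 * B) = B * (eta * t).
  by rewrite /eta; field; rewrite lt0r_neq0.
have hsmall (z : C) : normc z = r -> normc (h z) <= t / (4 * B).
  move=> hz; apply: le_trans (osc h ah _ _ nzr hz) _.
  by rewrite tB ler_pM2l // hw ltW.
have tB0 : 0 < t / (4 * B) by rewrite divr_gt0 //; lra.
have tBE : t / B = 4 * (t / (4 * B)) by field; rewrite lt0r_neq0.
have xs0 : nth 0 xs 0 \in xs by rewrite mem_nth // sxs.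
have d0 : normc (nth 0 xs 0) <= r by apply: le_trans (xsr0 _ xs0) (ltW r1).
have h0 := @algebraic_max _ T rho r _ h T0 r2 (ltW tB0) ah hsmall _ d0.
have := @algebraic_min_sub _ T rho r (3 * (t / (4 * B))) f h T0 r2.
rewrite mulr_gt0 // => /(_ isT af ah fh) hmin.
(* [|f - h|] is at least [3 t / (4 B)] on the circle, hence inside it, whereas at
   a node it is at most [m + t / (4 B)]. *)
have hcirc (z : C) : normc z = r -> 3 * (t / (4 * B)) <= normc (f z - h z).
  move=> hz; have h1 : t / B <= normc (f z).
    by rewrite ler_pdivrMr // mulrC; exact: osc f af _ _ hz nzr.
  have h2 := hsmall z hz; have h3 : normc (f z) <= normc (f z - h z) + normc (h z).
    by rewrite -{1}(subrK (h z) (f z)) le_normcD.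
  lra.
have h1 := hmin hcirc _ d0; have h2 := le_normcB (f (nth 0 xs 0)) (h (nth 0 xs 0)).
have h3 := hm _ xs0.
have h4 : 2 * m < t / B.
  rewrite ltr_pdivlMr // mulrC mulrA; apply: le_lt_trans C1m.
  by rewrite mulrC (mulrC C1) ler_wpM2l // mulrC.
by rewrite /= in h3 h0 h1; lra.
Qed.

End UniformBound.

Theorem theorem1p2 (R : realType) (k : nat) (rho : R) (K Omega : set R[i]^o)
    (rho_gt0 : 0 < rho)
    (K_compact : compact K) (K_disk : K `<=` disk rho) (K0 : K 0)
    (K_card : (`I_k.+1 #<= K)%card)
    (Omega_open : open Omega) (K_Omega : K `<=` Omega)
    (Omega_disk : closure Omega `<=` disk rho) :
  exists C : R, 0 < C /\
    forall f : R[i]^o -> R[i]^o, V k rho f ->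
      exists M m : R[i],
        [/\ is_max_modulus f (closure Omega) M,
            is_max_modulus f K m &
            M <= C%:C * m].
Proof.
have sub : closure Omega `<=` closed_disk rho by move=> z /Omega_disk /diskP /ltW.
have cO : compact (closure Omega).
  by apply: (subclosed_compact _ (@closed_disk_compact R rho)) => //; exact: closed_closure.
have KO : K `<=` closure Omega by move=> z /K_Omega; exact: subset_closure.
have O0 : closure Omega 0 by exact: KO.
have [|zm Ozm hzm] := max_on_compact cO (ex_intro _ _ O0) (g := fun z : R[i]^o => normc z).
  by move=> z _; exact: normc_continuous.
have [g] : $|{injfun `I_k.+1 >-> K}| by apply/pcard_leP.
pose xs0 : seq R[i]^o := [seq g i | i <- iota 0 k.+1].
have xs0K x : x \in xs0 -> K x.
  case/mapP=> i; rewrite mem_iota add0n => /andP[_ hi] ->.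
  exact: (@funS _ _ _ _ g i hi).
have uxs0 : uniq xs0.
  rewrite map_inj_in_uniq ?iota_uniq // => i j; rewrite !mem_iota !add0n => /andP[_ hi] /andP[_ hj].
  by apply: (@inj _ _ _ g); apply/mem_set.
have sxs0 : size xs0 = k.+1 by rewrite size_map size_iota.
have xsr : {in xs0, forall x, normc x <= normc zm}.
  by move=> x /xs0K /KO; exact: hzm.
have [A A0 hA] := uniform_bound_V (normc_ge0 zm) ((diskP _ _).1 (Omega_disk _ Ozm)) uxs0 sxs0 xsr.
exists A; split=> // f Vf; have [holf _] := Vf.
have cf z : disk rho z -> {for z, continuous (fun w => normc (f w) : R)}.
  by move=> /(holomorphic_continuous holf); exact: continuous_normc_comp.
have [|z1 Oz1 hz1] := max_on_compact cO (ex_intro _ _ O0) (g := fun z : R[i]^o => normc (f z)).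
  by move=> z /Omega_disk; exact: cf.
have [|z2 Kz2 hz2] := max_on_compact K_compact (ex_intro _ _ K0) (g := fun z : R[i]^o => normc (f z)).
  by move=> z /K_disk; exact: cf.
exists (normc (f z1))%:C, (normc (f z2))%:C; split.
- split; first by exists z1 => //; rewrite normr_normc.
  move=> z /hz1; rewrite -lecR normr_normc => le1. exact: le1.
- split; first by exists z2 => //; rewrite normr_normc.
  move=> z /hz2; rewrite -lecR normr_normc => le2; exact: le2.
have : normc (f z1) <= A * normc (f z2).
  apply: hA => //; first exact: normc_ge0.
    by move=> x /xs0K /hz2.
  exact: hzm.
by rewrite -lecR rmorphM => le12; exact: le12.
Qed.
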